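(* There is an algorithm (a dynamic program over the items in route order in which, for each item prefix, values $B'$ are rounded down to multiples of $r=\epsilon L/m$, with $L=\max_{e_{ij}}B'(\{e_{ij}\})$, and for each rounded value only the entry of minimal total weight is kept) which, for every PWT instance and every $\epsilon$ with $0<\epsilon\le 1$, outputs a solution $x\in\{0,1\}^m$ with $B'(x)\ge(1-\epsilon)\cdot OPT$, in time $O(m^3/\epsilon)$. In particular it is a fully polynomial time approximation scheme for maximising $B'$.
   Context: Packing While Traveling (PWT): there are $n+1$ cities on a fixed route $1,\dots,n+1$, with distances $d_i>0$ from city $i$ to city $i+1$. City $i$ ($1\le i\le n$) holds a set $M_i$ of items $e_{i1},\dots,e_{im_i}$, $m=\sum_i m_i$; item $e_{ij}$ has positive integer profit $p_{ij}$ and positive integer weight $w_{ij}$. The vehicle has speeds $0<v_{\min}<v_{\max}$ and capacity $W>0$; $\nu=(v_{\max}-v_{\min})/W$; renting rate $R>0$. For $x=(x_{ij})\in\{0,1\}^m$, $B(x)=\sum_{i,j}p_{ij}x_{ij}-R\sum_{i=1}^n \frac{d_i}{v_{\max}-\nu\sum_{k\le i}\sum_{j}w_{kj}x_{kj}}$, where it is assumed that all denominators are positive. $B(\emptyset)=-R\sum_i d_i/v_{\max}$ is the benefit of selecting nothing, and the objective is $B'(x)=B(x)-B(\emptyset)$, with $OPT=\max_{x\in\{0,1\}^m}B'(x)\ (\ge 0)$. Standing assumption: $m=\Omega(n)$; arithmetic operations are counted at unit cost. *)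

(* Defs.v *)
From HB Require Import structures.
From mathcomp Require Import all_boot all_order all_algebra.

Set Implicit Arguments.
Unset Strict Implicit.
Unset Printing Implicit Defensive.
Import Order.TTheory GRing.Theory Num.Theory.
Local Open Scope ring_scope.

(* Cities are numbered from 0: city [i : 'I_(ncity I)] is city [i + 1] of the
   route, and the last city of the route, which holds no items, is left out. *)
Record pwt (F : archiRealFieldType) := Pwt {
  ncity : nat;
  nitem : 'I_ncity -> nat;
  dist : 'I_ncity -> F;
  profit : forall i, 'I_(nitem i) -> nat;
  weight : forall i, 'I_(nitem i) -> nat;
  vmin : F;
  vmax : F;
  capacity : F;
  rent : F }.

Section Problem.
Variables (F : archiRealFieldType) (I : pwt F).

Definition item : finType := {i : 'I_(ncity I) & 'I_(nitem i)}.

Definition mk_item (i : 'I_(ncity I)) (j : 'I_(nitem i)) : item :=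
  Tagged (fun i => 'I_(nitem i)) j.

Definition item_profit (e : item) : nat := profit (tagged e).
Definition item_weight (e : item) : nat := weight (tagged e).

Definition total_items : nat := (\sum_(i < ncity I) nitem i)%N.

(* A solution x in {0,1}^m is the set of its selected items, so that x_ij is
   the boolean [mk_item j \in x]. *)
Definition load (x : {set item}) (i : 'I_(ncity I)) : nat :=
  (\sum_(k < ncity I | k <= i) \sum_(j < nitem k)
     weight j * (mk_item j \in x))%N.

Definition nu : F := (vmax I - vmin I) / capacity I.

Definition speed (x : {set item}) (i : 'I_(ncity I)) : F :=
  vmax I - nu * (load x i)%:R.

Definition benefit (x : {set item}) : F :=
  (\sum_(i < ncity I) \sum_(j < nitem i)
     profit j * (mk_item j \in x))%N%:R
  - rent I * \sum_(i < ncity I) dist i / speed x i.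

Definition gain (x : {set item}) : F := benefit x - benefit set0.

Definition opt : F := \big[Num.max/gain set0]_(x : {set item}) gain x.

Record pwt_valid : Prop := PwtValid {
  dist_gt0 : forall i : 'I_(ncity I), 0 < dist i;
  profit_gt0 : forall (i : 'I_(ncity I)) (j : 'I_(nitem i)), (0 < profit j)%N;
  weight_gt0 : forall (i : 'I_(ncity I)) (j : 'I_(nitem i)), (0 < weight j)%N;
  vmin_gt0 : 0 < vmin I;
  vmin_lt_vmax : vmin I < vmax I;
  capacity_gt0 : 0 < capacity I;
  rent_gt0 : 0 < rent I;
  speed_gt0 : forall (x : {set item}) (i : 'I_(ncity I)), 0 < speed x i }.

Definition route_items : seq item :=
  [seq mk_item j | i <- enum 'I_(ncity I), j <- enum 'I_(nitem i)].

Definition best_single : F :=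
  if route_items is e :: s
  then \big[Num.max/gain [set e]]_(f <- s) gain [set f] else 0.

(* The dynamic program. A table is the set of the partial solutions that are
   kept. Entries of negative gain are discarded: their number is not bounded
   by a polynomial in m and 1/eps, whereas the gain is at most m * L. *)
Section DynamicProgram.
Variable eps : F.

Definition grid : F := eps * best_single / total_items%:R.

Definition rounded_gain (x : {set item}) : F :=
  (Num.floor (gain x / grid))%:~R * grid.

Definition sol_weight (x : {set item}) : nat :=
  (\sum_(e in x) item_weight e)%N.

Definition candidates (T : {set {set item}}) (e : item) : {set {set item}} :=
  T :|: [set e |: x | x in T].

Definition kept (C T : {set {set item}}) : Prop :=
  [/\ T \subset [set x in C | 0 <= gain x],
      {in T &, injective rounded_gain} &
      {in C, forall y, 0 <= gain y ->
         exists2 x, x \in T &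
           rounded_gain x = rounded_gain y /\
           (sol_weight x <= sol_weight y)%N}].

Fixpoint dp_tables (T : {set {set item}}) (s : seq item)
    (T' : {set {set item}}) : Prop :=
  if s is e :: s' then
    exists T1, kept (candidates T e) T1 /\ dp_tables T1 s' T'
  else T' = T.

(* If L <= 0 there is no grid, and selecting nothing is optimal. *)
Definition dp_solution (x : {set item}) : Prop :=
  if 0 < best_single then
    exists T, [/\ dp_tables [set set0] route_items T, x \in T &
                  {in T, forall y, gain y <= gain x}]
  else x = set0.

End DynamicProgram.
End Problem.

(* A unit-cost random access machine, as a structured language over two kinds
   of infinite arrays, holding natural numbers and elements of F respectively.
   The first argument of an access is the name of the array. Every constant,
   memory access, arithmetic operation and comparison costs one unit, and so do
   every assignment and every test. The syntax does not mention F: the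
   constants are natural numbers. *)
Inductive nexp : Type :=
  | NConst of nat
  | NGet of nat & nexp
  | NAdd of nexp & nexp
  | NSub of nexp & nexp
  | NMul of nexp & nexp
  | NFloor of fexp
with fexp : Type :=
  | FOfNat of nexp
  | FGet of nat & nexp
  | FAdd of fexp & fexp
  | FSub of fexp & fexp
  | FMul of fexp & fexp
  | FDiv of fexp & fexp.

Inductive bexp : Type :=
  | BNle of nexp & nexp
  | BFle of fexp & fexp
  | BNot of bexp
  | BAnd of bexp & bexp.

Inductive cmd : Type :=
  | Skip
  | NSet of nat & nexp & nexp
  | FSet of nat & nexp & fexp
  | Seq of cmd & cmd
  | If of bexp & cmd & cmd
  | While of bexp & cmd.

Fixpoint ncost (a : nexp) : nat :=
  match a with
  | NConst _ => 1
  | NGet _ i => (ncost i).+1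
  | NAdd a1 a2 | NSub a1 a2 | NMul a1 a2 => (ncost a1 + ncost a2).+1
  | NFloor f => (fcost f).+1
  end%N
with fcost (f : fexp) : nat :=
  match f with
  | FOfNat a => (ncost a).+1
  | FGet _ i => (ncost i).+1
  | FAdd f1 f2 | FSub f1 f2 | FMul f1 f2 | FDiv f1 f2 =>
      (fcost f1 + fcost f2).+1
  end%N.

Fixpoint bcost (b : bexp) : nat :=
  match b with
  | BNle a1 a2 => (ncost a1 + ncost a2).+1
  | BFle f1 f2 => (fcost f1 + fcost f2).+1
  | BNot b1 => (bcost b1).+1
  | BAnd b1 b2 => (bcost b1 + bcost b2).+1
  end%N.

Section Semantics.
Variable F : archiRealFieldType.

Record state := State { nmem : nat -> nat -> nat; fmem : nat -> nat -> F }.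

Definition upd (V : Type) (m : nat -> nat -> V) (a i : nat) (v : V) :=
  fun b k => if (b == a) && (k == i) then v else m b k.

(* [NSub] is truncated subtraction, [NFloor] sends negative numbers to 0, and
   division by 0 yields 0. *)
Fixpoint neval (s : state) (a : nexp) : nat :=
  match a with
  | NConst k => k
  | NGet b i => nmem s b (neval s i)
  | NAdd a1 a2 => neval s a1 + neval s a2
  | NSub a1 a2 => neval s a1 - neval s a2
  | NMul a1 a2 => neval s a1 * neval s a2
  | NFloor f => Num.truncn (feval s f)
  end%N
with feval (s : state) (f : fexp) : F :=
  match f with
  | FOfNat a => (neval s a)%:R
  | FGet b i => fmem s b (neval s i)
  | FAdd f1 f2 => feval s f1 + feval s f2
  | FSub f1 f2 => feval s f1 - feval s f2
  | FMul f1 f2 => feval s f1 * feval s f2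
  | FDiv f1 f2 => feval s f1 / feval s f2
  end.

Fixpoint beval (s : state) (b : bexp) : bool :=
  match b with
  | BNle a1 a2 => (neval s a1 <= neval s a2)%N
  | BFle f1 f2 => feval s f1 <= feval s f2
  | BNot b1 => ~~ beval s b1
  | BAnd b1 b2 => beval s b1 && beval s b2
  end.

(* [exec c s t s']: started in [s], [c] halts in [s'] after [t] units. *)
Inductive exec : cmd -> state -> nat -> state -> Prop :=
  | ExecSkip s : exec Skip s 1 s
  | ExecNSet s a i e :
      exec (NSet a i e) s (ncost i + ncost e).+1
        (State (upd (nmem s) a (neval s i) (neval s e)) (fmem s))
  | ExecFSet s a i f :
      exec (FSet a i f) s (ncost i + fcost f).+1
        (State (nmem s) (upd (fmem s) a (neval s i) (feval s f)))
  | ExecSeq c1 c2 s t1 s1 t2 s2 :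
      exec c1 s t1 s1 -> exec c2 s1 t2 s2 -> exec (Seq c1 c2) s (t1 + t2)%N s2
  | ExecIf b c1 c2 s t s' :
      exec (if beval s b then c1 else c2) s t s' ->
      exec (If b c1 c2) s (bcost b + t).+1 s'
  | ExecWhileF b c s : ~~ beval s b -> exec (While b c) s (bcost b).+1 s
  | ExecWhileT b c s t1 s1 t2 s2 : beval s b ->
      exec c s t1 s1 -> exec (While b c) s1 t2 s2 ->
      exec (While b c) s (bcost b + t1 + t2).+1 s2.

Lemma exec_det c s t1 s1 t2 s2 :
  exec c s t1 s1 -> exec c s t2 s2 -> t1 = t2 /\ s1 = s2.
Proof.
move=> h; elim: h t2 s2 => {c s t1 s1}
  [s|s a i e|s a i f|c1 c2 s t1 s1 t2 s2 _ ih1 _ ih2|b c1 c2 s t s' _ ih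
  |b c s nb|b c s t1 s1 t2 s2 hb _ ih1 _ ih2] t3 s3 h; inversion h; subst => //.
- match goal with [h1 : exec c1 _ _ _, h2 : exec c2 _ _ _ |- _] =>
    have [-> e] := ih1 _ _ h1; subst; by have [-> ->] := ih2 _ _ h2 end.
- match goal with [h1 : exec (if _ then _ else _) _ _ _ |- _] =>
    by have [-> ->] := ih _ _ h1 end.
- match goal with [hb : is_true (beval s b) |- _] =>
    by rewrite hb in nb end.
- match goal with [nb : is_true (~~ _) |- _] => by rewrite hb in nb end.
- match goal with [h1 : exec c _ _ _, h2 : exec (While b c) ?s' _ _ |- _] =>
    have [-> e] := ih1 _ _ h1; subst s'; by have [-> ->] := ih2 _ _ h2 end.
Qed.

(* Every cell that does not hold the input is initially 0. The solution is
   returned in array 4 of naturals, item by item in route order. *)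
Definition scalars (I : pwt F) (eps : F) : seq F :=
  [:: vmin I; vmax I; capacity I; rent I; eps].

Definition input_state (I : pwt F) (eps : F) : state :=
  State
    (fun a k =>
       match a with
       | 0 => nth 0 [:: ncity I] k
       | 1 => nth 0 [seq nitem i | i <- enum 'I_(ncity I)] k
       | 2 => nth 0 [seq item_profit e | e <- route_items I] k
       | 3 => nth 0 [seq item_weight e | e <- route_items I] k
       | _ => 0
       end%N)
    (fun a k =>
       match a with
       | 0%N => nth 0 (scalars I eps) k
       | 1%N => nth 0 [seq dist i | i <- enum 'I_(ncity I)] k
       | _ => 0
       end).

Definition outputs (I : pwt F) (s : state) (x : {set item I}) : Prop :=
  forall e : item I, nmem s 4 (index e (route_items I)) = (e \in x) :> nat.

(* The number of cells that hold the input. *)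
Definition input_size (I : pwt F) : nat :=
  (2 * ncity I + 2 * total_items I + 6)%N.

End Semantics.

Definition pwt_class := forall F : archiRealFieldType, pwt F -> Prop.

(* The standing assumption m = Omega(n), with n <= c * m. *)
Definition item_rich (c : nat) : pwt_class :=
  fun F I => (ncity I <= c * total_items I)%N.

(* The last clause says polynomial in both the input size and 1/eps, since
   both numbers are at least 1. *)
Definition fptas (K : pwt_class) (A : cmd) : Prop :=
  (forall (F : archiRealFieldType) (I : pwt F) (eps : F),
     pwt_valid I -> K F I -> 0 < eps <= 1 ->
     exists t s (x : {set item I}),
       [/\ exec A (input_state I eps) t s, outputs s x &
           (1 - eps) * opt I <= gain x]) /\
  (exists C k : nat,
     forall (F : archiRealFieldType) (I : pwt F) (eps : F) t s,
     pwt_valid I -> K F I -> 0 < eps <= 1 ->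
     exec A (input_state I eps) t s ->
     t%:R <= C%:R * ((input_size I)%:R / eps) ^+ k).

(* Main.v *)
Require Import Defs.
From mathcomp Require Import all_boot all_order all_algebra.
From mathcomp Require Import zify ring lra.

Set Implicit Arguments.
Unset Strict Implicit.
Unset Printing Implicit Defensive.
Import Order.TTheory GRing.Theory Num.Theory.
Local Open Scope ring_scope.

(* If [x] and [y] only use items of cities up to [c], [S] only uses items of
   cities from [c] on and [x] is not heavier than [y], then adding [S] to [x]
   increases the gain at least as much as adding it to [y], because
   [w |-> 1 / (vmax - nu w)] is convex. Hence keeping only the lightest entry
   of each rounded value loses at most [grid] per item, that is [eps * L] in
   total, and [L <= OPT]. A discarded entry of negative gain is outdone by the
   empty selection, which is never evicted as it is the only one of weight 0.
   The same monotonicity gives [gain x <= m * L], so that a table has at most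
   [m ^ 2 / eps + 1] slots. From the city of an item on, the load of a
   selection of earlier items is constant, so the gain of an extension is
   computed in constant time from the gain and the weight stored in the table
   and from the distance left to travel. *)

(** * Gain of a selection *)

Section Gain.
Variables (F : archiRealFieldType) (I : pwt F).
Implicit Types (x y S : {set item I}) (e f : item I).

Definition sol_profit x : nat := (\sum_(e in x) item_profit e)%N.

Definition delay (w : nat) : F := (vmax I - nu I * w%:R)^-1.

(** Loads and profits are nested sums with an indicator; as sums over the selected items they split
    along disjoint unions. *)
Lemma sum_items_in x (P : pred 'I_(ncity I))
    (c : forall i : 'I_(ncity I), 'I_(nitem i) -> nat) :
  (\sum_(i < ncity I | P i) \sum_(j < nitem i) c i j * (mk_item j \in x) =
   \sum_(e in x | P (tag e)) c (tag e) (tagged e))%N.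
Proof.
rewrite (@sig_big_dep _ _ _ _ (fun i => 'I_(nitem i)) P (fun _ _ => true)
  (fun i j => c i j * (mk_item j \in x))%N) /=.
under eq_bigl do rewrite andbT.
rewrite big_mkcond [RHS]big_mkcond /=; apply: eq_bigr => -[i j] _ /=.
rewrite -/(mk_item j) andbC.
by case: (P i); case: (_ \in _); rewrite /= ?muln1 ?muln0.
Qed.

Lemma loadE x i : load x i = (\sum_(e in x | tag e <= i) item_weight e)%N.
Proof. exact: (sum_items_in x (fun k => k <= i)%N). Qed.

Lemma benefitE x :
  benefit x = (sol_profit x)%:R
    - rent I * \sum_(i < ncity I) dist i * delay (load x i).
Proof.
rewrite /benefit (sum_items_in x predT (@profit F I)) /sol_profit.
by congr (_%:R - _); apply: eq_bigl => e; rewrite andbT.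
Qed.

Lemma sum_setU_disjoint x S (c : item I -> nat) :
  [disjoint x & S] ->
  (\sum_(e in x :|: S) c e = \sum_(e in x) c e + \sum_(e in S) c e)%N.
Proof.
by move=> dxS; rewrite -bigU //; apply: eq_bigl => e; rewrite !inE.
Qed.

Lemma load_setU x S i :
  [disjoint x & S] -> load (x :|: S) i = (load x i + load S i)%N.
Proof. by move=> dxS; rewrite !loadE !big_mkcondr sum_setU_disjoint. Qed.

Lemma sol_weight_setU x S :
  [disjoint x & S] -> sol_weight (x :|: S) = (sol_weight x + sol_weight S)%N.
Proof. by move=> dxS; rewrite /sol_weight sum_setU_disjoint. Qed.

Lemma sol_profit_setU x S :
  [disjoint x & S] -> sol_profit (x :|: S) = (sol_profit x + sol_profit S)%N.
Proof. by move=> dxS; rewrite /sol_profit sum_setU_disjoint. Qed.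

Lemma load_before S (c : nat) (i : 'I_(ncity I)) :
  {in S, forall e, c <= tag e}%N -> (i < c)%N -> load S i = 0%N.
Proof.
move=> hS ic; rewrite loadE big1 // => e /andP[eS ei].
by have := hS e eS; rewrite leqNgt (leq_ltn_trans ei ic).
Qed.

Lemma load_after x (c : nat) (i : 'I_(ncity I)) :
  {in x, forall e, tag e <= c}%N -> (c <= i)%N -> load x i = sol_weight x.
Proof.
move=> hx ci; rewrite loadE /sol_weight; apply: eq_bigl => e.
by case ex: (e \in x) => //=; rewrite (leq_trans (hx e ex) ci).
Qed.

Lemma sol_weight0 : @sol_weight F I set0 = 0%N.
Proof. by rewrite /sol_weight big_set0. Qed.

Lemma gain0 : @gain F I set0 = 0.
Proof. exact: subrr. Qed.

(** Profit and load are additive on disjoint unions, so only the profit of [S] and the change of the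
    delay remain. *)
Lemma gain_setU x S : [disjoint x & S] ->
  gain (x :|: S) = gain x + ((sol_profit S)%:R
    - rent I * \sum_(i < ncity I)
        dist i * (delay (load x i + load S i) - delay (load x i))).
Proof.
move=> dxS; rewrite /gain !benefitE sol_profit_setU // natrD.
under eq_bigr do rewrite load_setU //.
under [X in _ = _ + (_ - _ * X)]eq_bigr do rewrite mulrBr.
rewrite [in RHS]sumrB; ring.
Qed.

Section Valid.
Hypothesis vI : pwt_valid I.

Lemma nu_ge0 : 0 <= nu I.
Proof.
rewrite divr_ge0 ?(ltW (capacity_gt0 vI)) // subr_ge0.
exact: ltW (vmin_lt_vmax vI).
Qed.

(* Convexity of [w |-> 1 / (vmax - nu w)]: the delay caused by extra weight
   grows with the weight already carried. *)
Lemma delay_increment_mono (a b s : nat) :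
  (a <= b)%N -> 0 < vmax I - nu I * (b + s)%:R ->
  delay (a + s) - delay a <= delay (b + s) - delay b.
Proof.
move=> ab; rewrite /delay !natrD.
have hab : nu I * a%:R <= nu I * b%:R by rewrite ler_wpM2l ?nu_ge0 ?ler_nat.
have hs : 0 <= nu I * s%:R by rewrite mulr_ge0 ?nu_ge0.
rewrite !mulrDr.
move: (nu I * a%:R) (nu I * b%:R) (nu I * s%:R) hab hs => u v z uv z0 pos.
(* As a single fraction the difference has numerator [z] whatever the load [c], so that only
   denominators have to be compared. *)
have diffE c : 0 < vmax I - (c + z) ->
    (vmax I - (c + z))^-1 - (vmax I - c)^-1 =
    z / ((vmax I - (c + z)) * (vmax I - c)).
  move=> hc; have hc' : 0 < vmax I - c by lra.
  by field; rewrite ?gt_eqF //; apply/andP; split; rewrite gt_eqF.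
rewrite !diffE //; last by lra.
have p1 : 0 < vmax I - v by lra.
have p2 : 0 < vmax I - u by lra.
have p3 : 0 < vmax I - (u + z) by lra.
rewrite ler_wpM2l // lef_pV2 ?posrE ?mulr_gt0 //; apply: ler_pM; lra.
Qed.

(** Before city [c] the set [S] weighs nothing and both increments vanish; from [c] on the loads of
    [x] and [y] are their full weights, and [delay_increment_mono] applies city by city. *)
Lemma gain_setU_mono x y S (c : nat) :
  [disjoint x & S] -> [disjoint y & S] ->
  {in x, forall e, tag e <= c}%N -> {in y, forall e, tag e <= c}%N ->
  {in S, forall e, c <= tag e}%N -> (sol_weight x <= sol_weight y)%N ->
  gain (y :|: S) - gain y <= gain (x :|: S) - gain x.
Proof.
move=> dx dy hx hy hS wxy; rewrite !gain_setU //.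
rewrite (addrC (gain y)) (addrC (gain x)) !addrK.
rewrite lerD2l lerN2 ler_wpM2l ?(ltW (rent_gt0 vI)) //.
apply: ler_sum => i _; apply: ler_wpM2l; first exact: ltW (dist_gt0 vI i).
have [ic|ci] := ltnP i c.
  by rewrite (load_before hS ic) !addn0 !subrr.
apply: delay_increment_mono; first by rewrite !(load_after _ ci).
by have := speed_gt0 vI (y :|: S) i; rewrite /speed load_setU.
Qed.

(** Subadditivity along the route: the case of [gain_setU_mono] in which the lighter selection is
    empty. *)
Lemma gain_setU_le x S (c : nat) :
  [disjoint x & S] -> {in x, forall e, tag e <= c}%N ->
  {in S, forall e, c <= tag e}%N -> gain (x :|: S) <= gain x + gain S.
Proof.
move=> dx hx hS; rewrite addrC -lerBlDr.
have := @gain_setU_mono set0 x S c; rewrite set0U gain0 subr0; apply => //.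
- by rewrite -setI_eq0 set0I.
- by move=> e; rewrite inE.
- by rewrite sol_weight0.
Qed.

(** The delay changes only from the city of [e] on, where the change is the same everywhere and
    factors out. The distance left is written as the whole route minus the part before [e], the two
    quantities that the program stores. *)
Lemma gain_setU1 x e : e \notin x -> {in x, forall f, tag f <= tag e}%N ->
  gain (e |: x) = gain x + ((item_profit e)%:R
    - rent I
      * (\sum_(i < ncity I) dist i - \sum_(i < ncity I | (i < tag e)%N) dist i)
      * (delay (sol_weight x + item_weight e) - delay (sol_weight x))).
Proof.
move=> ex hx; rewrite setUC gain_setU; last by rewrite disjoint_sym disjoints1.
rewrite /sol_profit big_set1; congr (_ + (_ - _)).
rewrite -mulrA; congr (_ * _).
rewrite [in RHS](bigID (fun i : 'I_(ncity I) => i < tag e)%N) /=.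
rewrite [X in _ = (X - _) * _]addrC addrK mulr_suml.
rewrite (bigID (fun i : 'I_(ncity I) => i < tag e)%N) /= big1 ?add0r.
  apply: eq_bigr => i; rewrite -leqNgt => ei; rewrite (load_after hx ei).
  rewrite (@load_after [set e] (tag e)) /sol_weight ?big_set1 //.
  by move=> f /set1P ->.
move=> i ie; rewrite (@load_before [set e] (tag e)) ?addn0 ?subrr ?mulr0 //.
by move=> f /set1P ->.
Qed.

(** Weights are positive. This is why nothing can replace the empty selection in a table. *)
Lemma sol_weight_eq0 x : sol_weight x = 0%N -> x = set0.
Proof.
move/eqP; rewrite sum_nat_eq0 => /forallP h; apply/setP => e; rewrite inE.
apply: negbTE; have := h e; case: (e \in x) => //=.
by rewrite /item_weight -leqn0 leqNgt (weight_gt0 vI).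
Qed.

End Valid.

(** * Items in route order, and bounds by single items *)

Lemma size_route_items : size (route_items I) = total_items I.
Proof.
rewrite size_allpairs_dep sumnE big_map big_enum /=.
by apply: eq_bigr => i _; rewrite size_enum_ord.
Qed.

Lemma mem_route_items e : e \in route_items I.
Proof.
by case: e => i j; apply/allpairsPdep; exists i, j; rewrite !mem_enum.
Qed.

Lemma route_items_uniq : uniq (route_items I).
Proof.
apply: allpairs_uniq_dep => [|i _|]; rewrite ?enum_uniq //.
by move=> [i j] [i' j'] _ _.
Qed.

Lemma route_items_sorted :
  pairwise (fun e f => tag e <= tag f)%N (route_items I).
Proof.
rewrite /route_items.
have : pairwise ltn (map val (enum 'I_(ncity I))).
  rewrite val_enum_ord -sorted_pairwise ?iota_ltn_sorted //.
  exact: ltn_trans.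
elim: (enum 'I_(ncity I)) => [//|i s IH] /= /andP[his hs].
rewrite pairwise_cat IH // andbT; apply/andP; split.
  apply/allrelP => e f /mapP[j _ ->] /allpairsPdep[i' [j' [i's _ ->]]] /=.
  by apply: ltnW; move/allP: his; apply; apply: map_f.
elim: (enum 'I_(nitem i)) => [//|j l IHl] /=; rewrite IHl andbT.
by apply/allP => f /mapP[j' _ ->].
Qed.

Lemma route_items_tag_le e0 k l :
  (k <= l < total_items I)%N ->
  (tag (nth e0 (route_items I) k) <= tag (nth e0 (route_items I) l))%N.
Proof.
rewrite leq_eqVlt => /andP[/orP[/eqP -> //|kl] lm].
have /(pairwiseP e0) := route_items_sorted; apply => //.
- by rewrite inE size_route_items (ltn_trans kl).
- by rewrite inE size_route_items.
Qed.

Definition prefix_items k : {set item I} :=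
  [set f in take k (route_items I)].

Lemma mem_prefix_items k f :
  (f \in prefix_items k) = (index f (route_items I) < k)%N.
Proof. by rewrite inE in_take ?mem_route_items. Qed.

Lemma index_route_items_lt f :
  (index f (route_items I) < total_items I)%N.
Proof. by rewrite -size_route_items index_mem mem_route_items. Qed.

Lemma index_nth_route_items e0 k : (k < total_items I)%N ->
  index (nth e0 (route_items I) k) (route_items I) = k.
Proof.
by move=> km; rewrite index_uniq ?size_route_items ?route_items_uniq.
Qed.

Lemma prefix_items_tag_le e0 k f : (k < total_items I)%N ->
  f \in prefix_items k -> (tag f <= tag (nth e0 (route_items I) k))%N.
Proof.
move=> km; rewrite mem_prefix_items => fk.
rewrite -[f in X in (X <= _)%N](nth_index e0 (mem_route_items f)).
by rewrite route_items_tag_le // (ltnW fk).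
Qed.

Lemma suffix_items_tag_ge e0 k f : (k < total_items I)%N ->
  f \notin prefix_items k -> (tag (nth e0 (route_items I) k) <= tag f)%N.
Proof.
move=> km; rewrite mem_prefix_items -leqNgt => fk.
rewrite -[f in X in (_ <= X)%N](nth_index e0 (mem_route_items f)).
by rewrite route_items_tag_le // fk index_route_items_lt.
Qed.

Lemma prefix_itemsS e0 k : (k < total_items I)%N ->
  prefix_items k.+1 = nth e0 (route_items I) k |: prefix_items k.
Proof.
move=> km; apply/setP => f; rewrite in_setU1 !mem_prefix_items ltnS leq_eqVlt.
congr (_ || _); apply/eqP/eqP => [<-|->]; last exact: index_nth_route_items.
by rewrite nth_index // mem_route_items.
Qed.

Lemma nth_notin_prefix e0 k : (k < total_items I)%N ->
  nth e0 (route_items I) k \notin prefix_items k.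
Proof. by move=> km; rewrite mem_prefix_items index_nth_route_items ?ltnn. Qed.

Lemma prefix_items_all x : x \subset prefix_items (total_items I).
Proof.
by apply/subsetP => f _; rewrite mem_prefix_items index_route_items_lt.
Qed.

(** The items of [x] are added in route order, and by [gain_setU_le] each of them contributes at
    most [b]. *)
Lemma gain_le_mul (vI : pwt_valid I) (b : F) x :
  0 <= b -> (forall e, gain [set e] <= b) -> gain x <= (total_items I)%:R * b.
Proof.
move=> b0 hb; suff h k : (k <= total_items I)%N ->
    gain (x :&: prefix_items k) <= k%:R * b.
  by have := h _ (leqnn _); rewrite (setIidPl (prefix_items_all x)).
elim: k => [_|k IH km].
  have -> : prefix_items 0 = set0.
    by apply/setP => f; rewrite mem_prefix_items inE.
  by rewrite setI0 gain0 mul0r.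
(* Some item exists because [k < total_items I]; it serves as the default value of [nth]. *)
have [e0 ek] : exists e0, e0 \in take k.+1 (route_items I).
  by case: (route_items I) size_route_items km => [<-//|e s _ _] /=;
    exists e; rewrite mem_head.
rewrite (prefix_itemsS e0 km) setIUr mulrSr mulrDl mul1r.
set e := nth e0 _ k.
apply: le_trans (_ : gain (x :&: prefix_items k) + b <= _); last first.
  by rewrite lerD2r IH // ltnW.
have [ex|ex] := boolP (e \in x); last first.
  suff -> : x :&: [set e] = set0 by rewrite set0U lerDl.
  by apply/eqP; rewrite setI_eq0 disjoint_sym disjoints1.
have -> : x :&: [set e] = [set e] by apply/setIidPr; rewrite sub1set.
rewrite setUC; apply: le_trans (gain_setU_le vI (c := tag e) _ _ _) _.
- rewrite disjoint_sym disjoints1 inE negb_and.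
  by rewrite (nth_notin_prefix e0 km) orbT.
- by move=> f; rewrite inE => /andP[_]; apply: prefix_items_tag_le.
- by move=> f /set1P ->.
- by rewrite lerD2l hb.
Qed.

Lemma gain_single_le_best e : gain [set e] <= best_single I.
Proof.
have := mem_route_items e; rewrite /best_single.
case: (route_items I) => [//|e1 s]; rewrite inE => /orP[/eqP ->|es].
  exact: bigmax_ge_id.
exact: (le_bigmax_seq _ _ predT (fun f => gain [set f]) es).
Qed.

Lemma best_single_le_opt : best_single I <= opt I.
Proof.
rewrite /best_single; case: (route_items I) => [|e s].
  by rewrite -(gain0) le_bigmax.
by apply: bigmax_le => [|f _]; apply: le_bigmax.
Qed.

Lemma best_single_le (b : F) :
  0 <= b -> (forall e, gain [set e] <= b) -> best_single I <= b.
Proof.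
move=> b0 hb; rewrite /best_single; case: (route_items I) => // e s.
exact: bigmax_le.
Qed.

End Gain.

(** * The tables as functions *)

Section Model.
Variables (F : archiRealFieldType) (I : pwt F) (eps : F) (e0 : item I).
Implicit Types (x y : {set item I}).

Definition item_at k : item I := nth e0 (route_items I) k.

Definition table := nat -> option {set item I}.

(** For a nonnegative gain this is the multiple of the grid that [rounded_gain] yields. Negative
    gains are sent to slot 0, but such selections are never stored. *)
Definition slot x : nat := Num.truncn (gain x / grid I eps).

(** A gain is at most [m * L], that is [m ^ 2 / eps] grid steps, and slots are counted from 0. *)
Definition nslots : nat :=
  (Num.truncn ((total_items I)%:R * (total_items I)%:R / eps : F)).+1.

Definition empty_table : table := fun _ => None.

(** A tie in weight keeps the older entry, as does the command [insert_new]. *)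
Definition insert (t : table) x : table :=
  if (0 <= gain x) &&
     (if t (slot x) is Some y then sol_weight x < sol_weight y else true)%N
  then fun q => if q == slot x then Some x else t q
  else t.

Definition extensions k (o : option {set item I}) : seq {set item I} :=
  if o is Some x then [:: x; item_at k |: x] else [::].

Fixpoint tab k : table :=
  if k is k'.+1 then
    foldl insert empty_table
      (flatten [seq extensions k' (tab k' q) | q <- iota 0 nslots])
  else fun q => if q == 0%N then Some set0 else None.

(** The form in which [dp_tables] speaks of a table. By [tab_sound] an entry occurs in its own slot
    only. *)
Definition tab_set k : {set {set item I}} :=
  [set x | tab k (slot x) == Some x].

Lemma tabS k : tab k.+1 = foldl insert empty_table
  (flatten [seq extensions k (tab k q) | q <- iota 0 nslots]).
Proof. by []. Qed.

Lemma insert_sound t x q y :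
  insert t x q = Some y ->
  t q = Some y \/ [/\ y = x, 0 <= gain x & slot x = q].
Proof.
rewrite /insert; case: ifP => [/andP[gx _]|_]; last by left.
by case: eqP => [-> [<-]|_]; [right|left].
Qed.

Lemma insert_dominates t x :
  0 <= gain x ->
  exists2 y, insert t x (slot x) = Some y & (sol_weight y <= sol_weight x)%N.
Proof.
move=> gx; rewrite /insert gx /=.
case tx: (t (slot x)) => [y|] /=; last by exists x; rewrite ?eqxx.
by case: ltnP => w; [exists x; rewrite ?eqxx|exists y].
Qed.

Lemma insert_mono t x q y : t q = Some y ->
  exists2 z, insert t x q = Some z & (sol_weight z <= sol_weight y)%N.
Proof.
move=> tq; rewrite /insert; case: ifP => [/andP[_]|_]; last by exists y.
case: eqP => [<-|_ _]; last by exists y.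
by rewrite tq => w; exists x => //; apply: ltnW.
Qed.

Lemma foldl_insert_sound s q x :
  foldl insert empty_table s q = Some x ->
  [/\ x \in s, 0 <= gain x & slot x = q].
Proof.
elim/last_ind: s => [//|s y IH]; rewrite foldl_rcons mem_rcons inE.
case/insert_sound => [/IH[-> -> ->]|[-> gy sy]]; first by rewrite orbT.
by rewrite eqxx.
Qed.

(** The bound holds once [y] is inserted and survives later insertions, which never raise the weight
    in a slot. *)
Lemma foldl_insert_dominates s y : y \in s -> 0 <= gain y ->
  exists2 x, foldl insert empty_table s (slot y) = Some x &
    (sol_weight x <= sol_weight y)%N.
Proof.
elim/last_ind: s => [//|s z IH]; rewrite mem_rcons inE foldl_rcons.
case/orP => [/eqP -> gz|ys gy]; first exact: insert_dominates.
have [x xs xy] := IH ys gy; have [u us ux] := insert_mono z xs.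
by exists u => //; apply: leq_trans xy.
Qed.

(** * Soundness and accuracy of the tables *)

Hypothesis vI : pwt_valid I.
Hypothesis heps : 0 < eps <= 1.
Hypothesis Lgt0 : 0 < best_single I.

Lemma total_items_gt0 : (0 < total_items I)%N.
Proof. exact: leq_ltn_trans (index_route_items_lt e0). Qed.

Lemma grid_gt0 : 0 < grid I eps.
Proof.
case/andP: heps => eps0 _.
by rewrite divr_gt0 ?mulr_gt0 // ltr0n total_items_gt0.
Qed.

Lemma rounded_gainE x :
  0 <= gain x -> rounded_gain eps x = (slot x)%:R * grid I eps.
Proof.
move=> gx; rewrite /rounded_gain; congr (_ * _).
have h : 0 <= gain x / grid I eps by rewrite divr_ge0 ?(ltW grid_gt0).
by rewrite /slot truncn_floor h natr_absz ger0_norm // floor_ge0.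
Qed.

(** This is [gain_le_mul] for [b = L]: by the choice of the grid, [m * L] is [m ^ 2 / eps] times the
    grid. *)
Lemma slot_lt_nslots x : (slot x < nslots)%N.
Proof.
case/andP: heps => eps0 _; rewrite ltnS; apply: le_truncn.
have m0 : 0 < (total_items I)%:R :> F by rewrite ltr0n total_items_gt0.
rewrite ler_pdivrMr ?grid_gt0 //.
have -> : (total_items I)%:R * (total_items I)%:R / eps * grid I eps =
    (total_items I)%:R * best_single I.
  by rewrite /grid; field; rewrite !gt_eqF.
apply: gain_le_mul => //; first exact: ltW.
exact: gain_single_le_best.
Qed.

Lemma slot0 : slot set0 = 0%N.
Proof. by rewrite /slot gain0 mul0r truncn0. Qed.

(** The gain of [x] is at least the lower end of the common slot, and that of [y] is below its upper
    end. *)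
Lemma gain_same_slot x y :
  0 <= gain x -> slot x = slot y -> gain y - grid I eps <= gain x.
Proof.
move=> gx xy; have g0 := grid_gt0.
have h : 0 <= gain x / grid I eps by rewrite divr_ge0 // ltW.
have hx : (slot x)%:R <= gain x / grid I eps by rewrite truncn_le.
have hy : gain y / grid I eps < (slot y).+1%:R by rewrite truncnS_gt.
rewrite ler_pdivlMr // in hx; rewrite ltr_pdivrMr // -xy mulrSr in hy.
lra.
Qed.

Lemma item_at_mem k :
  (k < total_items I)%N -> item_at k \in prefix_items I k.+1.
Proof. by move=> km; rewrite (prefix_itemsS e0 km) setU11. Qed.

Lemma prefix_items_subS k : prefix_items I k \subset prefix_items I k.+1.
Proof. by apply/subsetP => f; rewrite !mem_prefix_items => /leqW. Qed.

Lemma tab_sound k q x : (k <= total_items I)%N -> tab k q = Some x ->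
  [/\ x \subset prefix_items I k, 0 <= gain x & slot x = q].
Proof.
elim: k q x => [|k IH] q x km; last rewrite tabS.
  by rewrite /=; case: eqP => // -> [<-]; rewrite sub0set gain0 slot0.
case/foldl_insert_sound => /flattenP[s /mapP[q' _ ->]] + gx sx.
case tq: (tab k q') => [y|//] xy; split => //.
have [yk _ _] := IH _ _ (ltnW km) tq.
have yk1 := subset_trans yk (prefix_items_subS k).
case/predU1P: xy => [->|/predU1P[->|//]] //.
by rewrite subUset sub1set item_at_mem.
Qed.

(** Only the first [nslots] slots of layer [k] are scanned, which misses nothing: the slot of [y] is
    among them. *)
Lemma tab_dominates k q y z : (k < total_items I)%N -> tab k q = Some y ->
  z \in extensions k (Some y) -> 0 <= gain z ->
  exists2 x, tab k.+1 (slot z) = Some x & (sol_weight x <= sol_weight z)%N.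
Proof.
move=> km tq zy; rewrite tabS; apply: foldl_insert_dominates; apply/flattenP.
exists (extensions k (tab k q)); last by rewrite tq.
apply: (map_f (fun q => extensions k (tab k q))); rewrite mem_iota /= add0n.
by have [_ _ <-] := tab_sound (ltnW km) tq; apply: slot_lt_nslots.
Qed.

Lemma mem_tab_set k q x :
  (k <= total_items I)%N -> tab k q = Some x -> x \in tab_set k.
Proof.
by move=> km tq; rewrite inE; have [_ _ ->] := tab_sound km tq; apply/eqP.
Qed.

(** The empty selection is offered again to every layer, and whatever occupies slot 0 is no heavier,
    hence empty. *)
Lemma tab_set0 k : (k <= total_items I)%N -> tab k 0 = Some set0.
Proof.
elim: k => [//|k IH] km; have := IH (ltnW km).
case/(tab_dominates km (z := set0)); rewrite ?mem_head ?gain0 //.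
rewrite slot0 sol_weight0 => x -> /=; rewrite leqn0 => /eqP.
by move/(sol_weight_eq0 vI) ->.
Qed.

Lemma tab_kept k : (k < total_items I)%N ->
  kept eps (candidates (tab_set k) (item_at k)) (tab_set k.+1).
Proof.
move=> km; split.
- apply/subsetP => x; rewrite !inE => /eqP tx.
  have [_ gx _] := tab_sound km tx; rewrite gx andbT.
  move: tx; rewrite tabS.
  case/foldl_insert_sound => /flattenP[s /mapP[q _ ->]] + _ _.
  case tq: (tab k q) => [y|//] xy.
  have yk := mem_tab_set (ltnW km) tq; have := yk; rewrite inE => yk'.
  case/predU1P: xy => [->|/predU1P[->|//]]; first by rewrite yk'.
  by apply/orP; right; apply: imset_f.
- move=> x y; rewrite !inE => /eqP tx /eqP ty.
  have [_ gx _] := tab_sound km tx; have [_ gy _] := tab_sound km ty.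
  rewrite !rounded_gainE // => /(mulIf (lt0r_neq0 grid_gt0)) /eqP.
  by rewrite eqr_nat => /eqP sxy; move: ty; rewrite -sxy tx => -[].
- move=> z zC gz.
  have [y ty zy] : exists2 y, tab k (slot y) = Some y &
      z \in extensions k (Some y).
    case/setUP: zC => [|/imsetP[y]]; rewrite !inE => /eqP ty.
      by exists z => //; rewrite mem_head.
    by move=> ->; exists y => //; rewrite !inE eqxx orbT.
  have [x tx xz] := tab_dominates km ty zy gz.
  exists x; first exact: mem_tab_set tx.
  by have [_ gx sx] := tab_sound km tx; rewrite !rounded_gainE // sx.
Qed.

Lemma tab_set_start : tab_set 0 = [set set0].
Proof.
apply/setP => x; rewrite !inE /=; case: (slot x =P 0%N) => [_|sx].
  by rewrite (inj_eq (@Some_inj _)) eq_sym.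
by symmetry; apply/eqP => x0; rewrite x0 slot0 in sx.
Qed.

Lemma dp_tables_tab k : (k <= total_items I)%N ->
  dp_tables eps (tab_set k) (drop k (route_items I)) (tab_set (total_items I)).
Proof.
(* Induction on the number of items left. *)
move=> km; rewrite -(subKn km); elim: (_ - k)%N (leq_subr k (total_items I)).
  by move=> _; rewrite subn0 drop_oversize // size_route_items.
move=> j IH jm; set k' := (_ - j.+1)%N.
have k'm : (k' < total_items I)%N by rewrite /k'; lia.
rewrite (drop_nth e0) ?size_route_items //=; exists (tab_set k'.+1).
have -> : k'.+1 = (total_items I - j)%N by rewrite /k'; lia.
split; last exact/IH/ltnW.
have <- : k'.+1 = (total_items I - j)%N by rewrite /k'; lia.
exact: tab_kept.
Qed.

(** Each layer replaces the partial solution followed so far by an entry that is no heavier and at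
    most one grid step worse; [gain_setU_mono] carries this over to the completion by the rest of
    [O]. *)
Lemma tab_near_opt (O : {set item I}) k : (k <= total_items I)%N ->
  exists2 x, x \in tab_set k &
    gain O - k%:R * grid I eps <= gain (x :|: (O :\: prefix_items I k)).
Proof.
elim: k => [_|k IH km].
  exists set0; first by rewrite tab_set_start set11.
  have -> : prefix_items I 0 = set0.
    by apply/setP => f; rewrite mem_prefix_items inE.
  by rewrite setD0 set0U mul0r subr0.
have [x xk hx] := IH (ltnW km); have := xk; rewrite inE => /eqP tx.
set S := O :\: prefix_items I k.+1.
(* [z] treats item [k] the way [O] does, so the completed selection stays the same. *)
pose z := if item_at k \in O then item_at k |: x else x.
have zx : z \in extensions k (Some x).
  by rewrite /z !inE; case: ifP; rewrite eqxx ?orbT.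
have [xp gx _] := tab_sound (ltnW km) tx.
have zp : z \subset prefix_items I k.+1.
  have xp' := subset_trans xp (prefix_items_subS k).
  by rewrite /z; case: ifP => // _; rewrite subUset sub1set item_at_mem.
have zS : z :|: S = x :|: (O :\: prefix_items I k).
  rewrite /z /S (prefix_itemsS e0 km) -/(item_at k).
  apply/setP => f; rewrite (fun_if (fun A => f \in A :|: _)) !inE.
  have := nth_notin_prefix e0 km; rewrite inE -/(item_at k).
  case: (eqVneq f (item_at k)) => [->|fe] /negbTE; last by case: ifP.
  by move=> ->; case: (_ \in O); rewrite /= ?orbT ?orbF.
rewrite -zS in hx.
have dS y : y \subset prefix_items I k.+1 -> [disjoint y & S].
  move=> yp; rewrite -setI_eq0; apply/eqP/setP => f; rewrite !inE.
  by case fy: (f \in y) => //=; have := subsetP yp f fy; rewrite inE => ->.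
have tagS : {in S, forall f : item I, tag (item_at k) <= tag f}%N.
  move=> f /setDP[_ fp]; apply: suffix_items_tag_ge => //.
  by apply: contra fp; apply: (subsetP (prefix_items_subS k)).
have tagy y : y \subset prefix_items I k.+1 ->
    {in y, forall f : item I, tag f <= tag (item_at k)}%N.
  move=> yp f /(subsetP yp); rewrite (prefix_itemsS e0 km) in_setU1.
  by case/predU1P => [-> //|]; apply: prefix_items_tag_le.
have g0 := grid_gt0.
(* Being no heavier, [u] gains from [S] at least as much as [z] does, so the loss does not grow on
   the completion. *)
have main (u : {set item I}) : u \subset prefix_items I k.+1 ->
    (sol_weight u <= sol_weight z)%N -> gain z - grid I eps <= gain u ->
    gain O - k.+1%:R * grid I eps <= gain (u :|: S).
  move=> up wu gu.
  have := gain_setU_mono vI (dS u up) (dS z zp) (tagy u up) (tagy z zp) tagS wu.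
  rewrite mulrSr; lra.
have [gz|gz] := leP 0 (gain z).
  have [u tu uz] := tab_dominates km tx zx gz.
  have [up gu su] := tab_sound km tu.
  exists u; first exact: mem_tab_set tu.
  by apply: main => //; apply: gain_same_slot.
(* Here [z] was discarded for its negative gain; the empty selection is no heavier and better. *)
exists set0; first exact: mem_tab_set (tab_set0 km).
apply: main; rewrite ?sub0set ?sol_weight0 // gain0; lra.
Qed.

Lemma tab_dp_solution x : x \in tab_set (total_items I) ->
  {in tab_set (total_items I), forall y, gain y <= gain x} ->
  dp_solution eps x.
Proof.
move=> xT hx; rewrite /dp_solution Lgt0; exists (tab_set (total_items I)).
split=> //; rewrite -tab_set_start.
by have := dp_tables_tab (leq0n _); rewrite drop0.
Qed.

Lemma tab_approx x :
  {in tab_set (total_items I), forall y, gain y <= gain x} ->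
  (1 - eps) * opt I <= gain x.
Proof.
move=> hx; case/andP: heps => eps0 _.
have m0 : (total_items I)%:R != 0 :> F.
  by rewrite pnatr_eq0 -lt0n total_items_gt0.
(* After all items nothing is left to complete, and the loss is [m] grid steps, that is
   [eps * L]. *)
have hO (O : {set item I}) : gain O <= gain x + eps * best_single I.
  have [y /hx yx] := tab_near_opt O (leqnn _).
  rewrite (_ : _ :\: _ = set0); last first.
    by apply/eqP; rewrite setD_eq0 prefix_items_all.
  rewrite setU0 /grid mulrC divfK //; lra.
have h1 : opt I <= gain x + eps * best_single I by apply: bigmax_le.
have := ler_wpM2l (ltW eps0) (best_single_le_opt I); lra.
Qed.

End Model.

Lemma no_profitable_item (F : archiRealFieldType) (I : pwt F) (eps : F) :
  pwt_valid I -> best_single I <= 0 ->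
  (1 - eps) * opt I <= gain (set0 : {set item I}).
Proof.
move=> vI L0; suff -> : opt I = 0 by rewrite mulr0 gain0.
apply/eqP; rewrite eq_le -{2}(gain0 I) le_bigmax andbT.
apply: bigmax_le; rewrite ?gain0 // => x _.
rewrite -(mulr0 (total_items I)%:R); apply: gain_le_mul => // e.
exact: le_trans (gain_single_le_best e) L0.
Qed.

(** * Timed execution of commands *)

(** The arrays that a command may write, read off its syntax; [exec_unchanged] frames all others. *)
Fixpoint nwrites (c : cmd) : seq nat :=
  match c with
  | NSet a _ _ => [:: a]
  | Seq c1 c2 | If _ c1 c2 => nwrites c1 ++ nwrites c2
  | While _ c1 => nwrites c1
  | _ => [::]
  end.

Fixpoint fwrites (c : cmd) : seq nat :=
  match c with
  | FSet a _ _ => [:: a]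
  | Seq c1 c2 | If _ c1 c2 => fwrites c1 ++ fwrites c2
  | While _ c1 => fwrites c1
  | _ => [::]
  end.

Fixpoint loop_free (c : cmd) : bool :=
  match c with
  | Seq c1 c2 | If _ c1 c2 => loop_free c1 && loop_free c2
  | While _ _ => false
  | _ => true
  end.

(** A time bound for loop-free commands; the value at [While] is a dummy. *)
Fixpoint max_cost (c : cmd) : nat :=
  match c with
  | NSet _ i e => (ncost i + ncost e).+1
  | FSet _ i f => (ncost i + fcost f).+1
  | Seq c1 c2 => max_cost c1 + max_cost c2
  | If b c1 c2 => (bcost b + maxn (max_cost c1) (max_cost c2)).+1
  | _ => 1
  end%N.

Section Run.
Variable F : archiRealFieldType.
Implicit Types (s : state F) (Q : state F -> Prop) (c : cmd).

(** Lets loop-free commands be run by computation; the value at [While] is again a dummy. *)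
Fixpoint ceval c s : state F :=
  match c with
  | NSet a i e => State (upd (nmem s) a (neval s i) (neval s e)) (fmem s)
  | FSet a i f => State (nmem s) (upd (fmem s) a (neval s i) (feval s f))
  | Seq c1 c2 => ceval c2 (ceval c1 s)
  | If b c1 c2 => if beval s b then ceval c1 s else ceval c2 s
  | _ => s
  end.

Definition unchanged c s s' : Prop :=
  (forall a i, a \notin nwrites c -> nmem s' a i = nmem s a i) /\
  (forall a i, a \notin fwrites c -> fmem s' a i = fmem s a i).

(** A total correctness triple with a time budget: halting within [t] units is part of the claim. *)
Definition run c s (t : nat) Q : Prop :=
  exists t' s', [/\ exec c s t' s', (t' <= t)%N & Q s'].

Lemma exec_unchanged c s t s' : exec c s t s' -> unchanged c s s'.
Proof.
elim => {c s t s'} //=.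
- by move=> s a i e; split=> b k //=; rewrite inE /upd => /negbTE ->.
- by move=> s a i e; split=> b k //=; rewrite inE /upd => /negbTE ->.
- move=> c1 c2 s t1 s1 t2 s2 _ [n1 f1] _ [n2 f2]; split=> a i /=;
    rewrite mem_cat negb_or => /andP[a1 a2].
  + by rewrite n2 ?n1.
  + by rewrite f2 ?f1.
- move=> b c1 c2 s t s' _ [n1 f1]; split=> a i /=;
    rewrite mem_cat negb_or => /andP[a1 a2].
  + by apply: n1; case: ifP.
  + by apply: f1; case: ifP.
- move=> b c s t1 s1 t2 s2 _ _ [n1 f1] _ [n2 f2]; split=> a i /= ha.
  + by rewrite n2 ?n1.
  + by rewrite f2 ?f1.
Qed.

Lemma run_weaken c s t t' Q Q' :
  run c s t Q -> (t <= t')%N ->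
  (forall s', unchanged c s s' -> Q s' -> Q' s') -> run c s t' Q'.
Proof.
move=> [u [s1 [h ut hQ]]] tt' hQQ'; exists u, s1; split=> //.
  exact: leq_trans tt'.
by apply: hQQ' => //; apply: exec_unchanged h.
Qed.

Lemma run_le c s t t' Q : run c s t Q -> (t <= t')%N -> run c s t' Q.
Proof. by move=> h l; apply: run_weaken h l _. Qed.

Lemma run_loop_free c s Q : loop_free c -> Q (ceval c s) ->
  run c s (max_cost c) Q.
Proof.
suff h : loop_free c -> exists2 t, exec c s t (ceval c s) & (t <= max_cost c)%N.
  by move=> /h[t ht hc] hQ; exists t, (ceval c s).
elim: c s {Q} => //=.
- by move=> s _; exists 1%N => //; constructor.
- by move=> a i e s _; exists (ncost i + ncost e).+1 => //; constructor.
- by move=> a i e s _; exists (ncost i + fcost e).+1 => //; constructor.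
- move=> c1 IH1 c2 IH2 s /andP[lf1 lf2].
  have [t1 h1 l1] := IH1 s lf1; have [t2 h2 l2] := IH2 (ceval c1 s) lf2.
  exists (t1 + t2)%N.
    exact: ExecSeq h1 h2.
  exact: leq_add.
- move=> b c1 IH1 c2 IH2 s /andP[lf1 lf2].
  have [t1 h1 l1] := IH1 s lf1; have [t2 h2 l2] := IH2 s lf2.
  exists (bcost b + if beval s b then t1 else t2).+1.
    by apply: ExecIf; case: (beval s b).
  by rewrite ltnS leq_add2l leq_max; case: (beval s b); rewrite ?l1 ?l2 ?orbT.
Qed.

Lemma run_seq c1 c2 s t1 t2 Q :
  run c1 s t1 (fun s1 => unchanged c1 s s1 -> run c2 s1 t2 Q) ->
  run (Seq c1 c2) s (t1 + t2) Q.
Proof.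
move=> [u1 [s1 [h1 l1 /(_ (exec_unchanged h1)) [u2 [s2 [h2 l2 hQ]]]]]].
exists (u1 + u2)%N, s2; split=> //; first exact: ExecSeq h1 h2.
exact: leq_add.
Qed.

Lemma run_step c1 c2 s t Q : loop_free c1 ->
  (forall s1, s1 = ceval c1 s -> unchanged c1 s s1 -> run c2 s1 t Q) ->
  run (Seq c1 c2) s (max_cost c1 + t) Q.
Proof.
by move=> lf h; apply: run_seq; apply: run_loop_free => // u; apply: h.
Qed.

Lemma run_if b c1 c2 s t Q :
  (beval s b -> run c1 s t Q) -> (~~ beval s b -> run c2 s t Q) ->
  run (If b c1 c2) s ((bcost b).+1 + t) Q.
Proof.
move=> h1 h2; have [u [s' [h l hQ]]] :
    run (if beval s b then c1 else c2) s t Q.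
  by case: (boolP (beval s b)).
exists (bcost b + u).+1, s'; split=> //; first exact: ExecIf.
by rewrite addSn ltnS leq_add2l.
Qed.

(** [Inv k] is the state after [k] iterations. The budget [T k] varies, so that an inner loop is
    charged its true length; the last summand pays for the failing test. *)
Lemma run_while (Inv : nat -> state F -> Prop) (n : nat) (T : nat -> nat)
    b c s0 :
  (forall k s, (k < n)%N -> unchanged c s0 s -> Inv k s ->
     beval s b /\ run c s (T k) (Inv k.+1)) ->
  (forall s, unchanged c s0 s -> Inv n s -> ~~ beval s b) ->
  Inv 0%N s0 ->
  run (While b c) s0
    (\sum_(0 <= k < n) (T k + (bcost b).+1) + (bcost b).+1)%N (Inv n).
Proof.
move=> hstep hend hinit.
(* Here [j] is the number of iterations left. *)
suff main j : (j <= n)%N -> forall s, unchanged c s0 s -> Inv (n - j)%N s ->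
    run (While b c) s
      (\sum_(n - j <= k < n) (T k + (bcost b).+1) + (bcost b).+1)%N (Inv n).
  by have := main n (leqnn n) s0; rewrite subnn; apply.
elim: j => [_|j IH jn] s us; rewrite ?subn0 => hI.
  exists (bcost b).+1, s; split=> //; last by rewrite big_geq.
  by apply: ExecWhileF; apply: hend.
have jn' : (n - j.+1 < n)%N by lia.
have [hb [t1 [s1 [h1 l1 hI1]]]] := hstep _ _ jn' us hI.
have u1 : unchanged c s0 s1.
  have [n1 f1] := exec_unchanged h1; have [n0 f0] := us.
  by split=> a i ha; rewrite ?n1 ?n0 ?f1 ?f0.
rewrite subnSK // in hI1; have [t2 [s2 [h2 l2 hQ]]] := IH (ltnW jn) s1 u1 hI1.
exists (bcost b + t1 + t2).+1, s2; split=> //; first exact: ExecWhileT h1 h2.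
by rewrite big_ltn // subnSK //; lia.
Qed.

Lemma run_while_uniform (Inv : nat -> state F -> Prop) (n T : nat) b c s0 :
  (forall k s, (k < n)%N -> unchanged c s0 s -> Inv k s ->
     beval s b /\ run c s T (Inv k.+1)) ->
  (forall s, unchanged c s0 s -> Inv n s -> ~~ beval s b) ->
  Inv 0%N s0 ->
  run (While b c) s0 (n * (T + (bcost b).+1) + (bcost b).+1)%N (Inv n).
Proof.
move=> hstep hend hinit.
have := run_while (T := fun=> T) hstep hend hinit.
by rewrite sum_nat_const_nat subn0.
Qed.

End Run.

(** * The program *)

Declare Scope cmd_scope.
Local Notation "c1 ;; c2" := (Seq c1 c2)
  (at level 60, right associativity) : cmd_scope.
Local Open Scope cmd_scope.

(* Arrays 0 to 4 of naturals and 0 to 1 of F are fixed by [input_state]. The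
   arrays [a...] hold naturals and the arrays [f...] elements of F. *)
Local Notation aNcity := 0%N.
Local Notation aNitem := 1%N.
Local Notation aProfit := 2%N.
Local Notation aWeight := 3%N.
Local Notation aOut := 4%N.
Local Notation aCity := 5%N.
Local Notation aPos := 6%N.
Local Notation aCount := 7%N.
Local Notation aItem := 8%N.
Local Notation aSlot := 9%N.
Local Notation aNslots := 10%N.
Local Notation aUsed := 11%N.
Local Notation aLoad := 12%N.
Local Notation aTaken := 13%N.
Local Notation aPrev := 14%N.
Local Notation aTarget := 15%N.
Local Notation aBest := 16%N.
Local Notation aNewLoad := 17%N.
Local Notation aNewTaken := 18%N.
Local Notation fScalar := 0%N.
Local Notation fDist := 1%N.
Local Notation fStart := 2%N.
Local Notation fRoad := 3%N.
Local Notation fMax := 4%N.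
Local Notation fGrid := 5%N.
Local Notation fGain := 6%N.
Local Notation fNewGain := 7%N.
Local Notation fNu := 8%N.

Local Notation nvar a := (NGet a (NConst 0)).
Local Notation fvar a := (FGet a (NConst 0)).
Local Notation "a ::= e" := (NSet a (NConst 0) e) (at level 55) : cmd_scope.
Local Notation "a ::=f e" := (FSet a (NConst 0) e) (at level 55) : cmd_scope.
Local Notation incr a := (a ::= NAdd (nvar a) (NConst 1)).
Local Notation nlt a b := (BNot (BNle b a)).

(** Records for each item of the current city the distance travelled so far, and counts the items,
    since [m] is not part of the input. *)
Definition mark_city : cmd :=
  While (nlt (nvar aPos) (NGet aNitem (nvar aCity)))
    (FSet fStart (nvar aCount) (fvar fRoad) ;; incr aCount ;; incr aPos).

Definition mark_items : cmd :=
  While (nlt (nvar aCity) (nvar aNcity))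
    (aPos ::= NConst 0 ;;
     mark_city ;;
     fRoad ::=f FAdd (fvar fRoad) (FGet fDist (nvar aCity)) ;;
     incr aCity).

(* The change of the gain when item [aItem] is added to a selection of total
   weight [w] of earlier items: from its city on, the load is constant. *)
Definition increment (w : nexp) : fexp :=
  let slowness w' :=
    FDiv (FOfNat (NConst 1))
      (FSub (FGet fScalar (NConst 1)) (FMul (fvar fNu) (FOfNat w'))) in
  FSub (FOfNat (NGet aProfit (nvar aItem)))
    (FMul (FMul (FGet fScalar (NConst 3))
             (FSub (fvar fRoad) (FGet fStart (nvar aItem))))
       (FSub (slowness (NAdd w (NGet aWeight (nvar aItem)))) (slowness w))).

Definition set_nu : cmd :=
  fNu ::=f FDiv (FSub (FGet fScalar (NConst 1)) (FGet fScalar (NConst 0)))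
                (FGet fScalar (NConst 2)).

(** [fMax] starts at 0, so the outcome is the maximum of [L] and 0, which suffices to detect
    [L <= 0]. *)
Definition find_best_single : cmd :=
  While (nlt (nvar aItem) (nvar aCount))
    (fNewGain ::=f increment (NConst 0) ;;
     If (BFle (fvar fMax) (fvar fNewGain)) (fMax ::=f fvar fNewGain) Skip ;;
     incr aItem).

Definition cell_of (k q : nexp) : nexp := NAdd (NMul k (nvar aNslots)) q.

(** [aTaken] and [aPrev] record the last decision and the slot it came from. Selections are never
    stored explicitly, which keeps each insertion at constant cost. *)
Definition store_target : cmd :=
  NSet aUsed (nvar aTarget) (NConst 1) ;;
  NSet aLoad (nvar aTarget) (nvar aNewLoad) ;;
  FSet fGain (nvar aTarget) (fvar fNewGain) ;;
  NSet aTaken (nvar aTarget) (nvar aNewTaken) ;;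
  NSet aPrev (nvar aTarget) (nvar aSlot).

Definition insert_new : cmd :=
  If (BFle (FOfNat (NConst 0)) (fvar fNewGain))
    (aTarget ::= cell_of (NAdd (nvar aItem) (NConst 1))
                   (NFloor (FDiv (fvar fNewGain) (fvar fGrid))) ;;
     If (BAnd (BNle (NConst 1) (NGet aUsed (nvar aTarget)))
              (BNle (NGet aLoad (nvar aTarget)) (nvar aNewLoad)))
       Skip store_target)
    Skip.

Definition load_current : cmd :=
  let here := cell_of (nvar aItem) (nvar aSlot) in
  aNewTaken ::= NConst 0 ;;
  aNewLoad ::= NGet aLoad here ;;
  fNewGain ::=f FGet fGain here.

Definition load_extended : cmd :=
  let here := cell_of (nvar aItem) (nvar aSlot) in
  aNewTaken ::= NConst 1 ;;
  aNewLoad ::= NAdd (NGet aLoad here) (NGet aWeight (nvar aItem)) ;;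
  fNewGain ::=f FAdd (FGet fGain here) (increment (NGet aLoad here)).

Definition extend_cell : cmd :=
  If (BNle (NConst 1) (NGet aUsed (cell_of (nvar aItem) (nvar aSlot))))
    (load_current ;; insert_new ;; load_extended ;; insert_new) Skip.

Definition extend_layer : cmd :=
  While (nlt (nvar aSlot) (nvar aNslots)) (extend_cell ;; incr aSlot).

Definition fill_tables : cmd :=
  While (nlt (nvar aItem) (nvar aCount))
    (aSlot ::= NConst 0 ;; extend_layer ;; incr aItem).

Definition find_best_slot : cmd :=
  While (nlt (nvar aSlot) (nvar aNslots))
    (If (BAnd (BNle (NConst 1) (NGet aUsed (cell_of (nvar aItem) (nvar aSlot))))
              (BFle (FGet fGain (cell_of (nvar aItem) (nvar aBest)))
                    (FGet fGain (cell_of (nvar aItem) (nvar aSlot)))))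
       (aBest ::= nvar aSlot) Skip ;;
     incr aSlot).

(** Follows [aPrev] from the last layer to the first, reading off one decision per item. *)
Definition backtrack : cmd :=
  While (BNle (NConst 1) (nvar aItem))
    (NSet aOut (NSub (nvar aItem) (NConst 1))
       (NGet aTaken (cell_of (nvar aItem) (nvar aBest))) ;;
     aBest ::= NGet aPrev (cell_of (nvar aItem) (nvar aBest)) ;;
     aItem ::= NSub (nvar aItem) (NConst 1)).

Definition set_grid : cmd :=
  fGrid ::=f FDiv (FMul (FGet fScalar (NConst 4)) (fvar fMax))
                  (FOfNat (nvar aCount)) ;;
  aNslots ::= NAdd (NFloor (FDiv (FMul (FOfNat (nvar aCount))
                                       (FOfNat (nvar aCount)))
                                 (FGet fScalar (NConst 4)))) (NConst 1) ;;
  (* Cell 0 now holds the empty selection: its load and gain are the initial zeros of the memory. *)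
  aUsed ::= NConst 1 ;;
  aItem ::= NConst 0.

Definition dynamic_program : cmd :=
  set_grid ;; fill_tables ;; aSlot ::= NConst 0 ;; find_best_slot ;; backtrack.

Definition pwt_program : cmd :=
  mark_items ;; set_nu ;; find_best_single ;;
  If (BFle (fvar fMax) (FOfNat (NConst 0))) Skip dynamic_program.

Lemma map_cst (T U : Type) (u : U) (l : seq T) :
  [seq u | _ <- l] = nseq (size l) u.
Proof. by elim: l => //= t l ->. Qed.

(** * Correctness and cost of the commands *)

Section Program.
Variables (F : archiRealFieldType) (I : pwt F) (eps : F).
Implicit Types (s : state F) (x y : {set item I}).

Local Notation n := (ncity I).
Local Notation m := (total_items I).
Local Notation R := (route_items I).

Definition start (k : nat) : F := \sum_(i < n | (i < k)%N) dist i.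

(** The contents of [fStart] once the first [k] cities are processed. *)
Definition starts (k : nat) : seq F :=
  flatten [seq nseq (nitem i) (start i) | i <- take k (enum 'I_n)].

Lemma starts_all : starts n = [seq start (tag e) | e : item I <- R].
Proof.
rewrite /starts take_oversize ?size_enum_ord // /route_items map_flatten.
congr flatten; rewrite -map_comp; apply: eq_map => i /=.
by rewrite -map_comp /comp /= map_cst size_enum_ord.
Qed.

Lemma startsS k (kn : (k < n)%N) :
  starts k.+1 = starts k ++ nseq (nitem (Ordinal kn)) (start k).
Proof.
rewrite /starts (take_nth (Ordinal kn)) ?size_enum_ord //.
by rewrite map_rcons flatten_rcons (nth_ord_enum (Ordinal kn) (Ordinal kn)).
Qed.

Lemma startS k (kn : (k < n)%N) : start k.+1 = start k + dist (Ordinal kn).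
Proof.
rewrite /start (bigD1 (Ordinal kn)) //= addrC; congr (_ + _).
apply: eq_bigl => i; rewrite ltnS -val_eqE /=; lia.
Qed.

Lemma nitem_at k (kn : (k < n)%N) :
  nth 0%N [seq nitem i | i <- enum 'I_n] k = nitem (Ordinal kn).
Proof.
rewrite (nth_map (Ordinal kn)) ?size_enum_ord //.
by rewrite (nth_ord_enum (Ordinal kn) (Ordinal kn)).
Qed.

Lemma dist_at k (kn : (k < n)%N) :
  nth 0 [seq dist i | i <- enum 'I_n] k = dist (Ordinal kn).
Proof.
rewrite (nth_map (Ordinal kn)) ?size_enum_ord //.
by rewrite (nth_ord_enum (Ordinal kn) (Ordinal kn)).
Qed.

Lemma mkseq_upd (f : nat -> nat -> F) a k v :
  mkseq (upd f a k v a) k.+1 = rcons (mkseq (f a) k) v.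
Proof.
rewrite mkseqS /upd !eqxx /=; congr rcons; apply/eq_in_map => i.
by rewrite mem_iota /= add0n => ik; rewrite ltn_eqF.
Qed.

Lemma run_mark_city s (c : nat) :
  nmem s aNitem (nmem s aCity 0) = c -> nmem s aPos 0 = 0%N ->
  run mark_city s (c * 25 + 8)
    (fun s' => nmem s' aCount 0 = (nmem s aCount 0 + c)%N /\
       mkseq (fmem s' fStart) (nmem s aCount 0 + c) =
       mkseq (fmem s fStart) (nmem s aCount 0) ++ nseq c (fmem s fRoad 0)).
Proof.
move=> hc h0; set d := nmem s aCount 0; set r := fmem s fRoad 0.
pose Inv j s' := [/\ nmem s' aPos 0 = j, nmem s' aCount 0 = (d + j)%N &
  mkseq (fmem s' fStart) (d + j) = mkseq (fmem s fStart) d ++ nseq j r].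
apply: run_weaken
  (run_while_uniform (Inv := Inv) (n := c) (T := 17) _ _ _) _ _.
- move=> j s' jc [un uf] [hj hcount hseq].
  have ei : nmem s' aNitem (nmem s' aCity 0) = c by rewrite !un.
  split; first by rewrite /= ei hj -ltnNge.
  apply: (@run_loop_free _ _ _ (Inv j.+1)) => //; split.
  + by rewrite /= /upd /= hj addn1.
  + by rewrite /= /upd /= hcount addn1 addnS.
  + rewrite addnS /= hcount mkseq_upd hseq -cats1 -catA; congr (_ ++ _).
    by rewrite uf // -[[:: _]]/(nseq 1 r) -nseqD addn1.
- by move=> s' [un uf] [hj _ _]; rewrite /= hj !un // hc negbK.
- by split; rewrite ?addn0 ?cats0.
- by [].
- by move=> s' _ [_ -> ->].
Qed.

Lemma sum_nitem_at :
  (\sum_(0 <= k < n) nth 0 [seq nitem i | i <- enum 'I_n] k = m)%N.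
Proof.
rewrite big_mkord; apply: eq_bigr => i _; rewrite (nitem_at (ltn_ord i)).
by congr nitem; apply: val_inj.
Qed.

Definition located s : Prop :=
  [/\ nmem s aCount 0 = m, fmem s fRoad 0 = \sum_(i < n) dist i &
      forall e : item I, fmem s fStart (index e R) = start (tag e)].

(** Each inner loop is charged by the number of items of its city, and these numbers add up to
    [m]. *)
Lemma run_mark_items :
  run mark_items (input_state I eps) (n * 40 + m * 25 + 8) located.
Proof.
set s0 := input_state I eps.
pose Inv k s := [/\ nmem s aCity 0 = k, nmem s aCount 0 = size (starts k),
  mkseq (fmem s fStart) (size (starts k)) = starts k &
  fmem s fRoad 0 = start k].
pose T k := (nth 0 [seq nitem i | i <- enum 'I_n] k * 25 + 30)%N.
apply: run_weaken (run_while (Inv := Inv) (n := n) (T := T) _ _ _) _ _.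
- move=> k s kn [un uf] [hk hc hs hr].
  split; first by rewrite /= hk un //= -ltnNge.
  apply: run_le.
    apply: run_seq; apply: run_loop_free => // _.
    apply: run_seq; apply: run_weaken 
      (run_mark_city (c := nitem (Ordinal kn)) _ _) (leqnn _) _ => //.
      by rewrite /= /upd /= hk un //= (nitem_at kn).
    move=> s1 [un1 uf1]; rewrite /= /upd /= => -[hc1 hs1] _.
    rewrite !hc in hc1 hs1; rewrite hr hs in hs1.
    apply: run_loop_free => //; split.
    + by rewrite /= /upd /= un1 //= /upd /= hk addn1.
    + by rewrite /= /upd /= hc1 (startsS kn) size_cat size_nseq.
    + by rewrite (startsS kn) size_cat size_nseq.
    + rewrite /= /upd /= !uf1 //= !un1 //= /upd /= hk hr uf //= (dist_at kn).
      by rewrite -startS.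
  by rewrite /T (nitem_at kn) /=; lia.
- by move=> s [un uf] [hk _ _ _]; rewrite /= hk un //= negbK.
- split; rewrite /starts ?take0 //=.
  by rewrite /start big_pred0 // => i; rewrite ltn0.
- rewrite big_split /= sum_nat_const_nat /T big_split /= sum_nat_const_nat.
  by rewrite -big_distrl /= sum_nitem_at subn0; lia.
- move=> s _ [_ hc hs hr]; rewrite starts_all size_map size_route_items in hc hs.
  split=> // [|e].
    by rewrite hr /start; apply: eq_bigl => i; rewrite ltn_ord.
  have em := index_route_items_lt e.
  have := congr1 (fun l => nth 0 l (index e R)) hs.
  rewrite nth_mkseq // (nth_map e) ?size_route_items // => ->.
  by rewrite nth_index // mem_route_items.
Qed.

(* The part of the memory that the dynamic program reads and never writes. *)
Definition ready s : Prop :=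
  [/\ located s,
      forall e : item I, nmem s aProfit (index e R) = item_profit e,
      forall e : item I, nmem s aWeight (index e R) = item_weight e &
      [/\ fmem s fScalar 1 = vmax I, fmem s fScalar 3 = rent I,
          fmem s fScalar 4 = eps & fmem s fNu 0 = nu I]].

Lemma ready_unchanged c s s' :
  unchanged c s s' -> ready s ->
  all (fun a => a \notin nwrites c) [:: aProfit; aWeight; aCount] ->
  all (fun a => a \notin fwrites c) [:: fScalar; fStart; fRoad; fNu] ->
  ready s'.
Proof.
move=> [un uf] [[h1 h2 h3] h4 h5 [h6 h7 h8 h9]].
move=> /and4P[n2 n3 n7 _] /and5P[f0 f2 f3 f8 _].
by split=> [|e|e|]; rewrite ?un //; split; try move=> e; rewrite ?un ?uf.
Qed.

Hypothesis vI : pwt_valid I.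

(** The memory version of [gain_setU1]: the items of [x] precede [e], so their cities are not beyond
    that of [e]. *)
Lemma incrementE s (e : item I) w x :
  ready s -> nmem s aItem 0 = index e R -> neval s w = sol_weight x ->
  x \subset prefix_items I (index e R) ->
  gain x + feval s (increment w) = gain (e |: x).
Proof.
move=> [[h1 h2 h3] h4 h5 [h6 h7 h8 h9]] he hw xp.
have ne : nth e R (index e R) = e by rewrite nth_index // mem_route_items.
have em := index_route_items_lt e.
rewrite gain_setU1 //; first last.
- by move=> f /(subsetP xp) /(prefix_items_tag_le e em); rewrite ne.
- by apply/negP => /(subsetP xp); rewrite mem_prefix_items ltnn.
by rewrite /increment /= he hw h2 h3 h4 h5 h6 h7 h9 !mul1r.
Qed.

Lemma run_find_best_single s :
  ready s -> nmem s aItem 0 = 0%N -> fmem s fMax 0 = 0 ->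
  run find_best_single s (m * 70 + 8) (fun s' =>
    fmem s' fMax 0 = if 0 < best_single I then best_single I else 0).
Proof.
move=> rs hi hm.
(* The running maximum bounds 0 and the items seen so far, and it is attained by one of them. *)
pose Inv k s' := [/\ nmem s' aItem 0 = k, 0 <= fmem s' fMax 0,
  forall e : item I, (index e R < k)%N -> gain [set e] <= fmem s' fMax 0 &
  fmem s' fMax 0 = 0 \/ exists e : item I, fmem s' fMax 0 = gain [set e]].
apply: run_weaken (run_while_uniform (Inv := Inv) (n := m) (T := 60) _ _ _) _ _.
- move=> k s' km u' [hk h0 hle hex].
  have rs' : ready s' by apply: ready_unchanged u' rs _ _.
  have [[hc _ _] _ _ _] := rs'.
  split; first by rewrite /= hc hk -ltnNge.
  have [e ek] : exists e : item I, index e R = k.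
    case: R (index_nth_route_items (I := I)) (size_route_items I) => [|e l] h.
      by move=> m0; rewrite -m0 in km.
    by move=> _; exists (nth e (e :: l) k); apply: h.
  have ge : feval s' (increment (NConst 0)) = gain [set e].
    have := @incrementE s' e (NConst 0) set0 rs'; rewrite gain0 add0r setU0.
    by apply; rewrite ?ek ?sol_weight0 ?sub0set.
  apply: run_le.
    apply: run_step => // s1 E1 [un1 uf1].
    have g1 : fmem s1 fNewGain 0 = gain [set e] by rewrite -ge E1.
    apply: run_loop_free => //=; rewrite /= uf1 // g1.
    have mono (M : F) : fmem s' fMax 0 <= M -> gain [set e] <= M ->
        forall f : item I, (index f R < k.+1)%N -> gain [set f] <= M.
      move=> h1 h2 f; rewrite ltnS leq_eqVlt => /orP[/eqP fk|fk].
        rewrite (_ : f = e) // -[f](nth_index f (mem_route_items f)) fk -ek.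
        by rewrite nth_index // mem_route_items.
      by apply: le_trans h1; apply: hle.
    case: leP => hb; split; rewrite /= /upd /= ?un1 ?uf1 ?g1 ?hk ?addn1 //.
    + exact: le_trans hb.
    + exact: mono.
    + by right; exists e.
    + by apply: mono => //; apply: ltW.
  by [].
- by move=> s' u' [hk _ _ _]; have [[hc _ _] _ _ _] :=
    ready_unchanged u' rs isT isT; rewrite /= hk hc negbK.
- by split; rewrite ?hm //; left.
- by rewrite /=; lia.
- move=> s' _ [_ h0 hle hex].
  have Lb : best_single I <= fmem s' fMax 0.
    by apply: best_single_le => // e; apply/hle/index_route_items_lt.
  case: ltP => L0.
    case: hex => [h|[e he]]; first by rewrite h leNgt L0 in Lb.
    by apply/eqP; rewrite eq_le Lb he gain_single_le_best.
  case: hex => // -[e he]; apply/eqP; rewrite eq_le h0 andbT he.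
  exact: le_trans (gain_single_le_best e) L0.
Qed.

(** * The tables in memory *)

Variable e0 : item I.
Hypothesis heps : 0 < eps <= 1.
Hypothesis Lgt0 : 0 < best_single I.

Local Notation S := (nslots I eps).
Local Notation tab := (tab eps e0).
Local Notation insert := (insert eps).
Local Notation slot := (slot eps).
Local Notation item_at := (item_at e0).
Local Notation extensions := (extensions e0).

Definition working s : Prop :=
  [/\ ready s, nmem s aNslots 0 = S & fmem s fGrid 0 = grid I eps].

Lemma working_unchanged c s s' :
  unchanged c s s' -> working s ->
  all (fun a => a \notin nwrites c) [:: aProfit; aWeight; aCount; aNslots] ->
  all (fun a => a \notin fwrites c) [:: fScalar; fStart; fRoad; fNu; fGrid] ->
  working s'.
Proof.
move=> u [rs h1 h2] /and5P[n2 n3 n7 n10 _] /and5P[f0 f2 f3 f8 /andP[f5 _]].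
split; rewrite ?(proj1 u) ?(proj2 u) //.
by apply: ready_unchanged u rs _ _; rewrite /= ?n2 ?n3 ?n7 ?f0 ?f2 ?f3 ?f8.
Qed.

(* Layer [k] of the tables occupies the cells [k * S + q] with [q < S]. *)
Definition cell s (k q : nat) (o : option {set item I}) : Prop :=
  let c := (k * S + q)%N in
  nmem s aUsed c = isSome o :> nat /\
  forall x, o = Some x ->
    [/\ nmem s aLoad c = sol_weight x, fmem s fGain c = gain x &
        forall k', k = k'.+1 ->
          nmem s aTaken c = (item_at k' \in x) :> nat /\
          tab k' (nmem s aPrev c) = Some (x :\ item_at k')].

Definition holds s (T : nat -> table I) : Prop :=
  forall k q, (q < S)%N -> cell s k q (T k q).

Lemma cell_eq s s' k q o : let c := (k * S + q)%N in
  nmem s' aUsed c = nmem s aUsed c -> nmem s' aLoad c = nmem s aLoad c ->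
  nmem s' aTaken c = nmem s aTaken c -> nmem s' aPrev c = nmem s aPrev c ->
  fmem s' fGain c = fmem s fGain c -> cell s k q o -> cell s' k q o.
Proof. by rewrite /cell /= => -> -> -> -> ->. Qed.

Lemma holds_unchanged c s s' T :
  unchanged c s s' -> holds s T ->
  all (fun a => a \notin nwrites c) [:: aUsed; aLoad; aTaken; aPrev] ->
  fGain \notin fwrites c -> holds s' T.
Proof.
move=> [un uf] hT /and5P[n1 n2 n3 n4 _] f6 k q qS.
by apply: cell_eq (hT k q qS); rewrite ?un ?uf.
Qed.

(** Division with remainder by [S]. *)
Lemma cell_inj k q k' q' : (q < S)%N -> (q' < S)%N ->
  (k * S + q)%N = (k' * S + q')%N -> k = k' /\ q = q'.
Proof.
move=> qS q'S h; have S0 : (0 < S)%N by [].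
have := congr1 (divn^~ S) h; rewrite !divnMDl // !divn_small // !addn0 => kk.
by split=> //; move: h; rewrite kk => /addnI.
Qed.

(** The tables while layer [k.+1] is being filled, with [t] its current content. *)
Definition layers k (t : table I) : nat -> table I :=
  fun k' => if (k' <= k)%N then tab k'
            else if k' == k.+1 then t else empty_table I.

Lemma layers_current k t : layers k t k = tab k.
Proof. by rewrite /layers leqnn. Qed.

Lemma layers_next k t : layers k t k.+1 = t.
Proof. by rewrite /layers ltnn eqxx. Qed.

(** The hypothesis on [tab k q] says that [x] without item [k] is the entry being extended, which
    [aPrev] has to point to. *)
Lemma run_insert_new s k q x t :
  working s -> nmem s aItem 0 = k -> nmem s aSlot 0 = q ->
  fmem s fNewGain 0 = gain x -> nmem s aNewLoad 0 = sol_weight x ->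
  nmem s aNewTaken 0 = (item_at k \in x) :> nat ->
  tab k q = Some (x :\ item_at k) -> holds s (layers k t) ->
  run insert_new s 70 (fun s' => holds s' (layers k (insert t x))).
Proof.
move=> [rs hS hg] hk hq hgx hwx htx htab hT.
have sx := slot_lt_nslots e0 vI heps Lgt0 x.
have gE : beval s (BFle (FOfNat (NConst 0)) (fvar fNewGain)) = (0 <= gain x).
  by rewrite /= hgx.
apply: run_le.
apply: (run_if (t := 60)); rewrite gE => gx; last first.
  by apply: run_le; first apply: run_loop_free; rewrite // /insert (negbTE gx).
apply: run_le.
apply: run_step => // s1 E1 u1.
have tgt : nmem s1 aTarget 0 = (k.+1 * S + slot x)%N.
  by rewrite E1 /= /upd /= hk hS hgx hg addn1.
have hT1 : holds s1 (layers k t) by apply: holds_unchanged u1 hT _ _.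
have := hT1 k.+1 (slot x) sx; rewrite layers_next => -[used1 val1].
have [un1 uf1] := u1.
have hwx1 : nmem s1 aNewLoad 0 = sol_weight x by rewrite un1.
set keep := (0 <= gain x) &&
  (if t (slot x) is Some y then sol_weight x < sol_weight y else true)%N.
have keepE : beval s1
    (BAnd (BNle (NConst 1) (NGet aUsed (nvar aTarget)))
          (BNle (NGet aLoad (nvar aTarget)) (nvar aNewLoad))) = ~~ keep.
  rewrite /= tgt used1 hwx1 /keep gx; case tx: (t (slot x)) val1 => [y|] //= v.
  by have [-> _ _] := v y erefl; rewrite -leqNgt.
apply: (run_if (t := 30)); rewrite keepE ?negbK => hk'.
  apply: run_le; first apply: run_loop_free; rewrite //= /insert.
  by rewrite -/keep (negbTE hk').
apply: (run_le (run_loop_free _ _)) => //; rewrite /insert -/keep hk'.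
move=> k1 q1 q1S.
(* Only the target cell is written; all others are as before. *)
have [/(cell_inj q1S sx)[-> ->]|ne] :=
    eqVneq (k1 * S + q1)%N (k.+1 * S + slot x)%N.
  rewrite layers_next eqxx.
  split; first by rewrite /= /upd /= tgt eqxx.
  move=> _ [<-]; split=> [||k' [<-]].
  + by rewrite /= /upd /= tgt eqxx.
  + by rewrite /= /upd /= tgt eqxx uf1.
  + by rewrite /= /upd /= tgt eqxx /= !un1 // hq.
have -> : layers k (fun q0 => if q0 == slot x then Some x else t q0) k1 q1 =
    layers k t k1 q1.
  rewrite /layers; case: leqP => // _; case: (eqVneq k1 k.+1) => // ek.
  by rewrite ek in ne; case: (eqVneq q1) => // eq1; rewrite eq1 eqxx in ne.
by apply: cell_eq (hT1 k1 q1 q1S); rewrite /= /upd /= tgt (negbTE ne).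
all: by [].
Qed.

Lemma item_at_index k : (k < m)%N -> index (item_at k) R = k.
Proof. exact: index_nth_route_items. Qed.

(** The two insertions are those of [extensions]. Between them the current cell can be read again,
    since the first one only alters layer [k.+1]. *)
Lemma run_extend_cell s k q t :
  working s -> nmem s aItem 0 = k -> nmem s aSlot 0 = q -> (k < m)%N ->
  (q < S)%N -> holds s (layers k t) ->
  run extend_cell s 300
    (fun s' => holds s' (layers k (foldl insert t (extensions k (tab k q))))).
Proof.
move=> ws hk hq km qS hT.
have := hT k q qS; rewrite layers_current => -[used val].
have hS : nmem s aNslots 0 = S by case: ws.
have usedE : beval s (BNle (NConst 1)
    (NGet aUsed (cell_of (nvar aItem) (nvar aSlot)))) = isSome (tab k q).
  by rewrite /= hk hq hS used; case: (tab k q).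
apply: run_le.
apply: (run_if (t := 280)); rewrite usedE;
  case tkq: (tab k q) val => [y|] // val _;
  last exact: (run_le (run_loop_free _ _)).
have {val}[lE gE _] := val y erefl.
have [yp gy sy] := tab_sound (ltnW km) tkq.
have ey : item_at k \notin y.
  by apply/negP => /(subsetP yp); rewrite mem_prefix_items item_at_index ?ltnn.
apply: run_le.
apply: run_step => // s1 E1 u1; have [un1 uf1] := u1.
have ws1 : working s1 by apply: working_unchanged u1 ws _ _.
have hT1 : holds s1 (layers k t) by apply: holds_unchanged u1 hT _ _.
apply: run_seq; apply: run_weaken.
- apply: (run_insert_new (k := k) (q := q) (x := y) ws1 _ _ _ _ _ _ hT1).
  + by rewrite un1.
  + by rewrite un1.
  + by rewrite E1 /= /upd /= hk hq hS.
  + by rewrite E1 /= /upd /= hk hq hS.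
  + by rewrite E1 /= /upd /= (negbTE ey).
  + by rewrite tkq (setDidPl _) // disjoint_sym disjoints1.
- exact: leqnn.
move=> s2 u2 hT2 _; have [un2 uf2] := u2.
have ws2 : working s2 by apply: working_unchanged u2 ws1 _ _.
apply: run_step => // s3 E3 u3; have [un3 uf3] := u3.
have ws3 : working s3 by apply: working_unchanged u3 ws2 _ _.
have hT3 : holds s3 (layers k (insert t y)).
  by apply: holds_unchanged u3 hT2 _ _.
have hk2 : nmem s2 aItem 0 = k by rewrite un2 // un1.
have hq2 : nmem s2 aSlot 0 = q by rewrite un2 // un1.
have hS2 : nmem s2 aNslots 0 = S by case: ws2.
have := hT2 k q qS; rewrite layers_current tkq => -[_ /(_ y erefl)[lE2 gE2 _]].
have [rs2 _ _] := ws2; have [_ _ hw2 _] := rs2.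
have dy : [disjoint [set item_at k] & y] by rewrite disjoints1.
apply: (run_insert_new (k := k) (q := q) (x := item_at k |: y)
  ws3 _ _ _ _ _ _ hT3).
- by rewrite un3.
- by rewrite un3.
- rewrite -(@incrementE s2 (item_at k)
    (NGet aLoad (cell_of (nvar aItem) (nvar aSlot))) y rs2) ?item_at_index //.
  + by rewrite E3 -gE2 -hk2 -hq2 -hS2.
  + by rewrite /= hk2 hq2 hS2.
- rewrite E3 /= /upd /= hk2 hq2 hS2 lE2 sol_weight_setU // addnC.
  by rewrite /sol_weight big_set1 -{1}(item_at_index km) hw2.
- by rewrite E3 /= /upd /= setU11.
- by rewrite setU1K.
all: by [].
Qed.

Lemma run_extend_layer s k :
  working s -> nmem s aItem 0 = k -> nmem s aSlot 0 = 0%N -> (k < m)%N ->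
  holds s (layers k (empty_table I)) ->
  run extend_layer s (S * 320 + 8)
    (fun s' => holds s' (layers k (tab k.+1))).
Proof.
move=> ws hk hq km hT.
(* The next layer after the first [q] slots have been extended; [part S] is [tab k.+1] by
   definition. *)
pose part q := foldl insert (empty_table I)
  (flatten [seq extensions k (tab k q') | q' <- iota 0 q]).
pose Inv q s' := nmem s' aSlot 0 = q /\ holds s' (layers k (part q)).
apply: run_weaken
  (run_while_uniform (Inv := Inv) (n := S) (T := 310) _ _ _) _ _ => //.
- move=> q s' qS u' [hq' hT']; have [un' uf'] := u'.
  have ws' : working s' by apply: working_unchanged u' ws _ _.
  have hS' : nmem s' aNslots 0 = S by case: ws'.
  split; first by rewrite /= hS' hq' -ltnNge.
  apply: run_le.
    apply: run_seq; apply: run_weaken.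
    - by apply: (run_extend_cell ws' _ hq' km qS hT'); rewrite un'.
    - exact: leqnn.
    - move=> s1 u1 hT1 _; apply: run_loop_free => //; split.
        by rewrite /= /upd /= (proj1 u1) // hq' addn1.
      rewrite (_ : part q.+1 = foldl insert (part q) (extensions k (tab k q))).
        by apply: (holds_unchanged (c := incr aSlot) _ hT1) => //;
          split=> a i ha //=; rewrite /upd; move: ha; rewrite inE => /negbTE ->.
      rewrite /part -addn1 iotaD map_cat flatten_cat foldl_cat /= cats0.
      by rewrite add0n.
  by [].
- move=> s' u' [hq' _].
  have [_ hS' _] : working s' by apply: working_unchanged u' ws _ _.
  by rewrite /= hS' hq' negbK.
- by rewrite /=; lia.
- by move=> s' _ [_]; rewrite tabS.
Qed.

Lemma run_fill_tables s :
  working s -> nmem s aItem 0 = 0%N -> holds s (layers 0 (empty_table I)) ->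
  run fill_tables s (m * (S * 320 + 40) + 8)
    (fun s' => nmem s' aItem 0 = m /\ holds s' (layers m (empty_table I))).
Proof.
move=> ws hk hT.
pose Inv k s' := nmem s' aItem 0 = k /\ holds s' (layers k (empty_table I)).
apply: run_weaken (run_while_uniform (Inv := Inv) (n := m)
  (T := S * 320 + 30) _ _ _) _ _ => //.
- move=> k s' km u' [hk' hT'].
  have ws' : working s' by apply: working_unchanged u' ws _ _.
  have [[[hc _ _] _ _ _] _ _] := ws'.
  split; first by rewrite /= hc hk' -ltnNge.
  apply: run_le.
    apply: run_step => // s1 E1 u1; have [un1 uf1] := u1.
    apply: run_seq; apply: run_weaken.
    - apply: (run_extend_layer (k := k)) => //.
      + exact: working_unchanged u1 ws' _ _.
      + by rewrite un1.
      + by rewrite E1.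
      + exact: holds_unchanged u1 hT' _ _.
    - exact: leqnn.
    - move=> s2 u2 hT2 _; apply: run_loop_free => //; split.
        by rewrite /= /upd /= (proj1 u2) // un1 // hk' addn1.
      move=> k1 q1 q1S.
      have -> : layers k.+1 (empty_table I) k1 q1 = layers k (tab k.+1) k1 q1.
        rewrite /layers (leq_eqVlt k1 k.+1) ltnS.
        case: (eqVneq k1 k.+1) => [->|_] /=; first by rewrite ltnn.
        by case: leqP => // _; case: ifP.
      exact: cell_eq (hT2 k1 q1 q1S).
  by rewrite /=; lia.
- move=> s' u' [hk' _].
  have [[[hc _ _] _ _ _] _ _] : working s' by apply: working_unchanged u' ws _ _.
  by rewrite /= hc hk' negbK.
- by rewrite /=; lia.
Qed.

(** Slot 0, where the search starts, holds the empty selection, so [aBest] always points to an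
    occupied slot. *)
Lemma run_find_best_slot s :
  working s -> nmem s aItem 0 = m -> nmem s aSlot 0 = 0%N ->
  nmem s aBest 0 = 0%N -> holds s (layers m (empty_table I)) ->
  run find_best_slot s (S * 60 + 8) (fun s' =>
    exists2 x, tab m (nmem s' aBest 0) = Some x &
      forall q y, tab m q = Some y -> gain y <= gain x).
Proof.
move=> ws hk hq hb hT.
pose Inv q s' := nmem s' aSlot 0 = q /\
  exists2 x, tab m (nmem s' aBest 0) = Some x &
    forall q' y, (q' < q)%N -> tab m q' = Some y -> gain y <= gain x.
apply: run_weaken
  (run_while_uniform (Inv := Inv) (n := S) (T := 50) _ _ _) _ _ => //.
- move=> q s' qS u' [hq' [x hx hmax]]; have [un' uf'] := u'.
  have hS' : nmem s' aNslots 0 = S by rewrite un' //; case: ws.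
  have hk' : nmem s' aItem 0 = m by rewrite un'.
  have hT' : holds s' (layers m (empty_table I)).
    by apply: holds_unchanged u' hT _ _.
  split; first by rewrite /= hS' hq' -ltnNge.
  have [_ _ sx] := tab_sound (leqnn m) hx.
  have bS : (nmem s' aBest 0 < S)%N.
    by rewrite -sx; apply: slot_lt_nslots e0 _ _ _ _.
  have := hT' m _ bS; rewrite layers_current hx => -[_ /(_ x erefl)[_ gxE _]].
  have := hT' m q qS; rewrite layers_current => -[used val].
  apply: run_le.
    apply: run_seq; apply: (run_le (run_loop_free _ _)) => //.
      rewrite /= hk' hS' hq' used gxE.
      move=> _; apply: run_loop_free => //; split.
        by case: ifP => _; rewrite /= /upd /= hq' addn1.
      case tq: (tab m q) val => [y|] /= val; last first.
        rewrite /upd /=; exists x => // q' z.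
        rewrite ltnS leq_eqVlt => /predU1P[->|]; first by rewrite tq.
        exact: hmax.
      have [_ -> _] := val y erefl; case: leP => xy; rewrite /upd /=.
        exists y => // q' z; rewrite ltnS leq_eqVlt => /predU1P[->|q'q].
          by rewrite tq => -[<-].
        by move/(hmax _ _ q'q)/le_trans; apply.
      exists x => // q' z; rewrite ltnS leq_eqVlt => /predU1P[->|].
        by rewrite tq => -[<-]; apply: ltW.
      exact: hmax.
  by [].
- move=> s' [un' _] [hq' _].
  have hS' : nmem s' aNslots 0 = S by rewrite un' //; case: ws.
  by rewrite /= hS' hq' negbK.
- by split=> //; exists set0; rewrite ?hb //; apply: tab_set0.
- by rewrite /=; lia.
- move=> s' _ [_ [x hx hmax]]; exists x => // q y hy; apply: (hmax q) => //.
  have [_ _ <-] := tab_sound (leqnn m) hy.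
  exact: slot_lt_nslots e0 _ _ _ _.
Qed.

Lemma run_backtrack s x :
  working s -> nmem s aItem 0 = m -> tab m (nmem s aBest 0) = Some x ->
  holds s (layers m (empty_table I)) ->
  run backtrack s (m * 50 + 5) (fun s' => outputs s' x).
Proof.
move=> ws hk hx hT.
(* After [j] steps [aBest] points to the part of [x] among the first [m - j] items, and the output
   is right for the other items. *)
pose Inv j s' := [/\ nmem s' aItem 0 = (m - j)%N,
  tab (m - j) (nmem s' aBest 0) = Some (x :&: prefix_items I (m - j)) &
  forall e : item I, (m - j <= index e R)%N ->
    nmem s' aOut (index e R) = (e \in x) :> nat].
apply: run_weaken
  (run_while_uniform (Inv := Inv) (n := m) (T := 40) _ _ _) _ _ => //.
- move=> j s' jm u' [hk' hb' hout]; have [un' uf'] := u'.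
  have hS' : nmem s' aNslots 0 = S by rewrite un' //; case: ws.
  have hT' : holds s' (layers m (empty_table I)).
    by apply: holds_unchanged u' hT _ _.
  have [k kE] : exists k, (m - j = k.+1)%N by exists (m - j).-1; lia.
  have jE : (m - j.+1 = k)%N by lia.
  have km : (k < m)%N by lia.
  rewrite kE in hk' hb' hout.
  split; first by rewrite /= hk'.
  have [_ _ sx] := tab_sound km hb'.
  have bS : (nmem s' aBest 0 < S)%N.
    by rewrite -sx; apply: slot_lt_nslots e0 _ _ _ _.
  have := hT' k.+1 _ bS; rewrite /layers km hb' => -[_].
  case/(_ _ erefl) => _ _ /(_ k erefl)[takenE prevE].
  apply: (run_le (run_loop_free _ _)) => //; split; rewrite jE.
  + by rewrite /= /upd /= hk' subn1.
  + rewrite /= /upd /= hk' hS' prevE; congr Some; apply/setP => f.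
    rewrite !in_setD1 !in_setI (prefix_itemsS e0 km) in_setU1 -/(item_at k).
    case: eqVneq => //= ->.
    by rewrite mem_prefix_items item_at_index // ltnn andbF.
  + move=> e ke; rewrite /= /upd /= hk' subn1 /=.
    case: eqVneq => [ek|nek]; last first.
      by apply: hout; rewrite ltn_neqAle eq_sym nek.
    rewrite hS' takenE; have -> : item_at k = e.
      by rewrite /item_at -ek nth_index // mem_route_items.
    by rewrite in_setI mem_prefix_items ek ltnS leqnn andbT.
- by move=> s' _ [hk' _ _]; rewrite /= hk' subnn.
- split; rewrite ?subn0 ?(setIidPl (prefix_items_all x)) // => e.
  by rewrite leqNgt index_route_items_lt.
- by rewrite /=; lia.
- by move=> s' _ [_ _ hout] e; apply: hout; rewrite subnn.
Qed.

Lemma run_dynamic_program s :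
  ready s -> fmem s fMax 0 = best_single I -> nmem s aBest 0 = 0%N ->
  (forall i, nmem s aUsed i = 0%N) -> (forall i, nmem s aLoad i = 0%N) ->
  (forall i, fmem s fGain i = 0) ->
  run dynamic_program s ((m.+1 * S.+1) * 500) (fun s' =>
    exists x : {set item I},
      [/\ outputs s' x, x \in tab_set eps e0 m &
          {in tab_set eps e0 m, forall y, gain y <= gain x}]).
Proof.
move=> rs hL hb0 hu hl hg.
have [[hc _ _] _ _ [_ _ heps' _]] := rs.
apply: run_le.
apply: run_step => // s1 E1 u1; have [un1 uf1] := u1.
have ws1 : working s1.
  split; first exact: ready_unchanged u1 rs _ _.
    by rewrite E1 /= /upd /= hc heps' addn1.
  by rewrite E1 /= /upd /= heps' hL hc.
have hT1 : holds s1 (layers 0 (empty_table I)).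
  move=> k q qS; rewrite /layers leqn0.
  have [->|k0] := eqVneq k 0%N.
    rewrite /=; case: eqVneq => [->|q0].
      split; first by rewrite E1 /= /upd.
      move=> y [<-]; split=> //; first by rewrite un1 // hl sol_weight0.
      by rewrite uf1 // hg gain0.
    split=> //; rewrite E1 /= /upd /= add0n (negbTE q0); exact: hu.
  (* The only cell marked so far is 0, and it is in layer 0 because [S] is positive. *)
  rewrite if_same; split=> //; rewrite E1 /= /upd /=.
  case: eqVneq => [h|_]; last exact: hu.
  by exfalso; move: h k0 (isT : 0 < S)%N; nia.
apply: run_seq; apply: run_weaken.
- by apply: (run_fill_tables ws1 _ hT1); rewrite E1.
- exact: leqnn.
move=> s2 u2 [hk2 hT2] _; have [un2 uf2] := u2.
have ws2 : working s2 by apply: working_unchanged u2 ws1 _ _.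
apply: run_step => // s3 E3 u3; have [un3 uf3] := u3.
have ws3 : working s3 by apply: working_unchanged u3 ws2 _ _.
have hT3 : holds s3 (layers m (empty_table I)).
  by apply: holds_unchanged u3 hT2 _ _.
apply: run_seq; apply: run_weaken.
- apply: (run_find_best_slot ws3 _ _ _ hT3).
  + by rewrite un3.
  + by rewrite E3.
  + by rewrite un3 // un2 // un1.
- exact: leqnn.
move=> s4 u4 [x hx hmax] _; have [un4 uf4] := u4.
have ws4 : working s4 by apply: working_unchanged u4 ws3 _ _.
have hT4 : holds s4 (layers m (empty_table I)).
  by apply: holds_unchanged u4 hT3 _ _.
apply: run_weaken.
- by apply: (run_backtrack ws4 _ hx hT4); rewrite un4 // un3.
- exact: leqnn.
move=> s5 _ out; exists x; split=> //; first exact: mem_tab_set hx.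
by move=> y; rewrite inE => /eqP; apply: hmax.
by rewrite /=; nia.
Qed.

End Program.

(** * The whole program and its running time *)

Section Theorem3.
Variables (F : archiRealFieldType) (I : pwt F) (eps : F).
Hypothesis vI : pwt_valid I.
Hypothesis heps : 0 < eps <= 1.

Local Notation n := (ncity I).
Local Notation m := (total_items I).

Lemma run_pwt_program :
  run pwt_program (input_state I eps) ((n + m.+1 * (nslots I eps).+1) * 1000)
    (fun s => exists x : {set item I},
       [/\ outputs s x, dp_solution eps x & (1 - eps) * opt I <= gain x]).
Proof.
set s0 := input_state I eps.
apply: run_le.
apply: run_seq; apply: run_weaken (run_mark_items I eps) (leqnn _) _.
move=> s1 u1 loc1 _; have [un1 uf1] := u1.
apply: run_step => // s2 E2 u2; have [un2 uf2] := u2.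
have rs2 : ready I eps s2.
  have [h1 h2 h3] := loc1; split.
  - by split=> [||e]; rewrite ?un2 ?uf2.
  - move=> e; rewrite un2 // un1 //= (nth_map e) ?index_mem ?mem_route_items //.
    by rewrite nth_index // mem_route_items.
  - move=> e; rewrite un2 // un1 //= (nth_map e) ?index_mem ?mem_route_items //.
    by rewrite nth_index // mem_route_items.
  - by split; do [by rewrite uf2 // uf1 | by rewrite E2 /= /upd /= !uf1].
apply: run_seq; apply: run_weaken.
- apply: (run_find_best_single rs2).
  + by rewrite un2 // un1.
  + by rewrite uf2 // uf1.
- exact: leqnn.
move=> s3 u3 hL _; have [un3 uf3] := u3.
have rs3 : ready I eps s3 by apply: ready_unchanged u3 rs2 _ _.
have bE : beval s3 (BFle (fvar fMax) (FOfNat (NConst 0))) =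
    (best_single I <= 0).
  transitivity (fmem s3 fMax 0 <= 0 :> F); first by [].
  by rewrite hL; case: (ltP 0) => [/lt_geF -> //|_]; rewrite lexx.
(* If [L <= 0] the program stops, and the untouched zeros of the output array encode the empty
   selection. *)
apply: (run_if (t := (m.+1 * (nslots I eps).+1) * 500)); rewrite bE => L0.
  apply: (run_le (run_loop_free _ _)); rewrite // ?muln_gt0 //=.
  exists set0; split; last exact: no_profitable_item.
    by move=> e; rewrite un3 // un2 // un1 // inE.
  by rewrite /dp_solution ltNge L0.
rewrite -ltNge in L0.
have [e0 _] : exists e : item I, true.
  move: L0; rewrite /best_single.
  by case: (route_items I) => [|e l]; rewrite ?ltxx //; exists e.
apply: run_weaken.
- apply: (run_dynamic_program vI e0 heps L0 rs3).
  + by rewrite hL L0.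
  + by rewrite un3 // un2 // un1.
  + by move=> i; rewrite un3 // un2 // un1.
  + by move=> i; rewrite un3 // un2 // un1.
  + by move=> i; rewrite uf3 // uf2 // uf1.
- exact: leqnn.
move=> s4 _ [x [out xT hx]]; exists x; split=> //.
- exact: tab_dp_solution xT hx.
- exact: tab_approx hx.
by rewrite /=; nia.
Qed.

(** By determinism every execution is the one of [run_pwt_program], and the truncation in [nslots]
    is at most its argument. *)
Lemma pwt_program_time t s : exec pwt_program (input_state I eps) t s ->
  t%:R <= 1000 * (n%:R + m.+1%:R * (m%:R * m%:R / eps + 2)).
Proof.
move=> h; have [t' [s' [h' l _]]] := run_pwt_program.
have [-> _] := exec_det h h'.
apply: le_trans (_ : ((n + m.+1 * (nslots I eps).+1) * 1000)%:R <= _).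
  by rewrite ler_nat.
rewrite natrM mulrC ler_wpM2l // natrD natrM lerD2l ler_wpM2l //.
rewrite /nslots -addn2 natrD lerD2r truncn_le.
by case/andP: heps => eps0 _; rewrite divr_ge0 ?mulr_ge0 // ltW.
Qed.

End Theorem3.

Theorem theorem3 :
  exists A : cmd,
    [/\ (forall (F : archiRealFieldType) (I : pwt F) (eps : F),
           pwt_valid I -> 0 < eps <= 1 ->
           exists (t : nat) (s : state F) (x : {set item I}),
             [/\ exec A (input_state I eps) t s,
                 outputs s x,
                 dp_solution eps x &
                 (1 - eps) * opt I <= gain x]),
        (forall c : nat, exists C : nat,
           forall (F : archiRealFieldType) (I : pwt F) (eps : F)
                  (t : nat) (s : state F),
           pwt_valid I -> item_rich c I -> (0 < total_items I)%N ->
           0 < eps <= 1 ->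
           exec A (input_state I eps) t s ->
           t%:R <= C%:R * (total_items I)%:R ^+ 3 / eps) &
        (forall c : nat, fptas (item_rich c) A)].
Proof.
exists pwt_program.
have correct (F : archiRealFieldType) (I : pwt F) (eps : F) :
    pwt_valid I -> 0 < eps <= 1 ->
    exists (t : nat) (s : state F) (x : {set item I}),
      [/\ exec pwt_program (input_state I eps) t s, outputs s x,
          dp_solution eps x & (1 - eps) * opt I <= gain x].
  move=> vI heps; have [t [s [h _ [x [h1 h2 h3]]]]] := run_pwt_program vI heps.
  by exists t, s, x.
split=> // [c|c].
(* The constant comes from [n <= c * m <= c * m ^ 3 / eps] and [(m + 1) * (m ^ 2 / eps + 2) <= 2 * m
   * (3 * m ^ 2 / eps)]. *)
- exists (1000 * (c + 6))%N => F I eps t s vI rich m0 heps h.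
  apply: le_trans (pwt_program_time vI heps h) _.
  case/andP: (heps) => eps0 eps1.
  have m1 : 1 <= (total_items I)%:R :> F by rewrite ler1n.
  have nc : (ncity I)%:R <= c%:R * (total_items I)%:R :> F.
    by rewrite -natrM ler_nat.
  have c0 : 0 <= c%:R :> F by [].
  rewrite natrM natrD -[leRHS]mulrA -[leRHS]mulrA.
  rewrite ler_wpM2l // -natr1.
  move: (total_items I)%:R (ncity I)%:R (c%:R : F) m1 nc c0 => m n d m1 nc c0.
  have ie : 1 <= eps^-1 by rewrite invf_ge1.
  move: (eps^-1) ie => i ie.
  have h2 : m * m * 1 <= m * m * i by apply: ler_wpM2l => //; nra.
  have h3 : m * 1 * 1 <= m * (m * m * i) by apply: ler_pM; nra.
  have h4 : d * m <= d * (m * (m * m * i)) by apply: ler_wpM2l => //; lra.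
  have h5 : (m + 1) * (m * m * i + 2) <= (2 * m) * (3 * (m * m * i)).
    by apply: ler_pM; nra.
  have -> : (d + 6) * (m ^+ 3 * i) =
      d * (m * (m * m * i)) + 2 * m * (3 * (m * m * i)).
    by ring.
  lra.
split=> [F I eps vI _ heps|].
  have [t [s [x [h1 h2 h3 h4]]]] := correct F I eps vI heps.
  by exists t, s, x.
(* With [z] the input size, [n] and [(m + 1) * (m ^ 2 / eps + 2)] are each at most [(z / eps) ^ 3],
   whence the factor 2. *)
exists (1000 * 2)%N, 3%N => F I eps t s vI _ heps h.
apply: le_trans (pwt_program_time vI heps h) _.
case/andP: (heps) => eps0 eps1.
have m0 : 0 <= (total_items I)%:R :> F by [].
have n0 : 0 <= (ncity I)%:R :> F by [].
have -> : (input_size I)%:R =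
    2 * (ncity I)%:R + 2 * (total_items I)%:R + 6 :> F.
  by rewrite /input_size natrD natrD !natrM.
rewrite -[(total_items I).+1%:R]natr1.
move: (total_items I)%:R (ncity I)%:R m0 n0 => m n m0 n0.
have ie : 1 <= eps^-1 by rewrite invf_ge1.
move: (eps^-1) ie => i ie.
set z := 2 * n + 2 * m + 6.
have z1 : 6 <= z by rewrite /z; lra.
have zi : z * 1 <= z * i by apply: ler_wpM2l; lra.
have h1 : (m + 1) * (m * m * i + 2) <= z * i * ((z * i) * (z * i)).
  have mz : m * m + 2 <= z * z by rewrite /z; nra.
  have i0 : 0 <= i by lra.
  have := ler_wpM2r i0 mz; have := ler_wpM2l (mulr_ge0 (sqr_ge0 z) i0) ie.
  have : 0 <= m * m * i by rewrite !mulr_ge0.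
  rewrite expr2 => *; apply: ler_pM; [lra|lra| |lra].
  by apply: le_trans zi; rewrite /z; lra.
have h2 : n * 1 <= (z * i) * ((z * i) * (z * i)).
  have nz : n <= z by rewrite /z; lra.
  have z2 : 1 * 1 <= (z * i) * (z * i) by apply: ler_pM; lra.
  by apply: ler_pM; lra.
rewrite (_ : _ ^+ 3 = z * i * ((z * i) * (z * i))); last by ring.
have h3 : n + (m + 1) * (m * m * i + 2) <= 2 * (z * i * ((z * i) * (z * i))).
  lra.
apply: le_trans (ler_wpM2l _ h3) _ => //.
by rewrite natrM -[leRHS]mulrA.
Qed.
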